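(* Let $\mathbb{M}\subset\mathbb{R}^3$ be a regular smooth oriented surface containing a regular arc length parametrized curve $c$ of umbilic points, and let $(u,v)$ be the chart $\alpha$ of $\mathbb{M}$ near $c$ with associated functions $k(u)$ and $a(u)$ described in the context. Let $\mathcal{H}$ be the mean curvature of $\mathbb{M}$ in this chart. Suppose that $\nabla\mathcal{H}(u,0)=(k'(u),a(u)/2)$ is not zero at a point $u=u_0$. Then the principal foliations near the point $c(u_0)$ of the curve are as follows. (i) If $k'(u_0)\neq0$, then both principal foliations are transversal to the curve $c$ of umbilic points (near $c(u_0)$). (ii) If $k'(u_0)=0$, $k''(u_0)\neq0$ and $a(u_0)\neq0$, then one principal foliation is transversal to $c$ and the other foliation has quadratic contact with the curve $c$ at the point $c(u_0)$.
   Context: Let $N$ be the positive unit normal field of $\mathbb{M}$ and $T=c'$, with $\{T,N\wedge T,N\}$ a positive frame along $c$ ($\wedge$ is the cross product). Near $c$, the surface is parametrized by $$\alpha(u,v)=c(u)+v\,(N\wedge T)(u)+\Big[\tfrac12 k(u)v^2+\tfrac16 a(u)v^3+\tfrac1{24}b(u)v^4+\text{h.o.t.}\Big]N(u),$$ where $k(u)$ is the normal curvature of $\mathbb{M}$ at the umbilic point $c(u)$, $a$ and $b$ are smooth functions, and ''h.o.t.'' are smooth terms of order at least $5$ in $v$. The umbilic curve $c$ is $\{v=0\}$. With $E,F,G$ and $e,f,g$ the coefficients of the first and second fundamental forms in the chart $\alpha$, principal curvature lines are the solutions of $$(Fg-Gf)\,dv^2+(Eg-Ge)\,du\,dv+(Ef-Fe)\,du^2=0.$$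 All three coefficients vanish on $v=0$ and are thus divisible by $v$. ''Principal foliations near a point of $c$'' means the two families of integral curves, in a neighborhood of that point and including the points of $c$, of the equation obtained after dividing by $v$. Its restriction to $v=0$ is $-k'(u)\,dv^2+a(u)\,du\,dv+k'(u)\,du^2=0$. A foliation has quadratic contact with $c$ at $c(u_0)$ if its leaf through $c(u_0)$ is, in the chart, of the form $v=\lambda(u-u_0)^2+o((u-u_0)^2)$ with $\lambda\neq0$. *)

(* Defs.v *)
From Stdlib Require Import Reals.
From Coquelicot Require Import Coquelicot.
Open Scope R_scope.

(** * Vectors of R^3 *)

Definition R3 : Type := (R * R * R)%type.

Definition coord1 (p : R3) : R := fst (fst p).
Definition coord2 (p : R3) : R := snd (fst p).
Definition coord3 (p : R3) : R := snd p.

Definition dot (p q : R3) : R :=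
  coord1 p * coord1 q + coord2 p * coord2 q + coord3 p * coord3 q.

Definition cross (p q : R3) : R3 :=
  (coord2 p * coord3 q - coord3 p * coord2 q,
   coord3 p * coord1 q - coord1 p * coord3 q,
   coord1 p * coord2 q - coord2 p * coord1 q).

Definition add3 (p q : R3) : R3 := plus p q.
Definition scale3 (s : R) (p : R3) : R3 :=
  (s * coord1 p, s * coord2 p, s * coord3 p).

(** * Smooth maps *)

(** The open interval with (possibly infinite) end points [lo] and [hi]. *)
Definition between (lo hi : Rbar) (t : R) : Prop := Rbar_lt lo t /\ Rbar_lt t hi.

Definition smooth1 (I : R -> Prop) (f : R -> R) : Prop :=
  forall (n : nat) (t : R), I t -> ex_derive_n f n t.

Definition smooth2 (W : R * R -> Prop) (f : R -> R -> R) : Prop :=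
  forall (n : nat) (u v : R), W (u, v) -> ex_diff_n f n u v.

Definition smooth_curve (I : R -> Prop) (c : R -> R3) : Prop :=
  smooth1 I (fun t => coord1 (c t)) /\
  smooth1 I (fun t => coord2 (c t)) /\
  smooth1 I (fun t => coord3 (c t)).

Definition smooth_map (W : R * R -> Prop) (x : R -> R -> R3) : Prop :=
  smooth2 W (fun u v => coord1 (x u v)) /\
  smooth2 W (fun u v => coord2 (x u v)) /\
  smooth2 W (fun u v => coord3 (x u v)).

Definition Derive3 (c : R -> R3) (t : R) : R3 :=
  (Derive (fun s => coord1 (c s)) t,
   Derive (fun s => coord2 (c s)) t,
   Derive (fun s => coord3 (c s)) t).

Definition du (x : R -> R -> R3) (u v : R) : R3 := Derive3 (fun s => x s v) u.
Definition dv (x : R -> R -> R3) (u v : R) : R3 := Derive3 (fun s => x u s) v.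

(** * Surfaces in R^3 *)

(** [x], restricted to the open set [W], is a smooth regular local
    parametrization of [M].  The last clause says that [x] maps open subsets of
    [W] to relatively open subsets of [M], so that [x] is a homeomorphism onto
    an open piece of [M]. *)
Definition local_parametrization
    (M : R3 -> Prop) (W : R * R -> Prop) (x : R -> R -> R3) : Prop :=
  open W /\
  smooth_map W x /\
  (forall u v, W (u, v) -> M (x u v)) /\
  (forall u v, W (u, v) -> cross (du x u v) (dv x u v) <> (0, 0, 0)) /\
  (forall u v u' v', W (u, v) -> W (u', v') -> x u v = x u' v' ->
     (u, v) = (u', v')) /\
  (forall W' : R * R -> Prop, open W' -> (forall w, W' w -> W w) ->
     exists O : R3 -> Prop, open O /\
       forall p, (M p /\ O p) <-> (exists u v, W' (u, v) /\ x u v = p)).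

Definition regular_surface (M : R3 -> Prop) : Prop :=
  forall p, M p ->
    exists (W : R * R -> Prop) (x : R -> R -> R3),
      local_parametrization M W x /\ exists u v, W (u, v) /\ x u v = p.

(** An orientation of [M] is given by its positive unit normal field; only the
    values of [N] on [M] matter. *)
Definition unit_normal_field (M : R3 -> Prop) (N : R3 -> R3) : Prop :=
  forall (W : R * R -> Prop) (x : R -> R -> R3),
    local_parametrization M W x ->
    smooth_map W (fun u v => N (x u v)) /\
    forall u v, W (u, v) ->
      dot (N (x u v)) (N (x u v)) = 1 /\
      dot (N (x u v)) (du x u v) = 0 /\
      dot (N (x u v)) (dv x u v) = 0.

(** * Fundamental forms in a parametrization *)

Section FundamentalForms.

Variables (N : R3 -> R3) (x : R -> R -> R3).

Definition ffE (u v : R) : R := dot (du x u v) (du x u v).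
Definition ffF (u v : R) : R := dot (du x u v) (dv x u v).
Definition ffG (u v : R) : R := dot (dv x u v) (dv x u v).

Definition sfe (u v : R) : R := dot (du (du x) u v) (N (x u v)).
Definition sff (u v : R) : R := dot (dv (du x) u v) (N (x u v)).
Definition sfg (u v : R) : R := dot (dv (dv x) u v) (N (x u v)).

Definition normal_curvature (u v p q : R) : R :=
  (sfe u v * p ^ 2 + 2 * sff u v * p * q + sfg u v * q ^ 2) /
  (ffE u v * p ^ 2 + 2 * ffF u v * p * q + ffG u v * q ^ 2).

Definition mean_curvature (u v : R) : R :=
  (ffE u v * sfg u v - 2 * ffF u v * sff u v + ffG u v * sfe u v) /
  (2 * (ffE u v * ffG u v - ffF u v ^ 2)).

(** [div_v phi] is the quotient of [phi] by [v], extended to [v = 0] by its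
    limit; it is used for functions [phi] vanishing on [v = 0]. *)
Definition div_v (phi : R -> R -> R) (u v : R) : R :=
  if Req_EM_T v 0 then Derive (fun s => phi u s) 0 else phi u v / v.

(** The equation of the principal curvature lines after division by [v], at
    [(u, v)] and for the direction [(p, q)] = [(du, dv)]. *)
Definition divided_principal_equation (u v p q : R) : Prop :=
  div_v (fun u v => ffF u v * sfg u v - ffG u v * sff u v) u v * q ^ 2 +
  div_v (fun u v => ffE u v * sfg u v - ffG u v * sfe u v) u v * p * q +
  div_v (fun u v => ffE u v * sff u v - ffF u v * sfe u v) u v * p ^ 2 = 0.

End FundamentalForms.

(** [p] is an umbilic point of [M], the common value of the normal curvatures of
    [M] at [p] in all the directions being [kappa]. *)
Definition umbilic_with_curvature
    (M : R3 -> Prop) (N : R3 -> R3) (pt : R3) (kappa : R) : Prop :=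
  M pt /\
  forall (W : R * R -> Prop) (x : R -> R -> R3) (u v : R),
    local_parametrization M W x -> W (u, v) -> x u v = pt ->
    forall p q : R, (p, q) <> (0, 0) -> normal_curvature N x u v p q = kappa.

(** * Foliations of open sets of the plane *)

(** A line field is represented by a vector field [X] spanning it. *)
Definition parallel (X Y : R * R) : Prop := fst X * snd Y - snd X * fst Y = 0.

(** A parametrized plane curve, defined on the open interval ]lo, hi[. *)
Record curve : Type := Curve { lo : R; hi : R; pos : R -> R * R }.

Definition dom (g : curve) (t : R) : Prop := lo g < t < hi g.

Definition velocity (g : curve) (t : R) : R * R :=
  (Derive (fun s => fst (pos g s)) t, Derive (fun s => snd (pos g s)) t).

(** Regular C^1 integral curves, contained in [U], of the line field [X]. *)
Definition integral_curve (U : R * R -> Prop) (X : R * R -> R * R) (g : curve)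
    : Prop :=
  forall t, dom g t ->
    U (pos g t) /\
    ex_derive (fun s => fst (pos g s)) t /\
    ex_derive (fun s => snd (pos g s)) t /\
    continuous (velocity g) t /\
    velocity g t <> (0, 0) /\
    parallel (velocity g t) (X (pos g t)).

(** The integral curves of [X] form a foliation of [U]: one and, up to
    reparametrization, only one of them passes through each point. *)
Definition foliation (U : R * R -> Prop) (X : R * R -> R * R) : Prop :=
  (forall w, U w -> continuous X w /\ X w <> (0, 0)) /\
  (forall w, U w -> exists (g : curve) (t : R),
     integral_curve U X g /\ dom g t /\ pos g t = w) /\
  (forall (g g' : curve) (t t' : R),
     integral_curve U X g -> integral_curve U X g' ->
     dom g t -> dom g' t' -> pos g t = pos g' t' ->
     locally t (fun s => exists s', dom g' s' /\ pos g' s' = pos g s)).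

(** The two families of integral curves, in [U], of the divided equation: at each
    point, its solutions are exactly the directions of the transversal line
    fields [X] and [Y]. *)
Definition principal_foliations
    (N : R3 -> R3) (x : R -> R -> R3) (U : R * R -> Prop)
    (X Y : R * R -> R * R) : Prop :=
  foliation U X /\ foliation U Y /\
  (forall w, U w -> ~ parallel (X w) (Y w)) /\
  (forall u v, U (u, v) -> forall p q : R,
     divided_principal_equation N x u v p q <->
     (parallel (p, q) (X (u, v)) \/ parallel (p, q) (Y (u, v)))).

(** At each of their common points with the curve [v = 0], the integral curves
    are not tangent to it. *)
Definition transversal_to_axis (U : R * R -> Prop) (X : R * R -> R * R) : Prop :=
  forall (g : curve) (t : R),
    integral_curve U X g -> dom g t -> snd (pos g t) = 0 ->
    ~ parallel (velocity g t) (1, 0).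

(** Near [(u0, 0)] the leaf through this point is the graph [v = h u] of a
    function with [h u = lambda (u - u0)^2 + o((u - u0)^2)] and [lambda <> 0]. *)
Definition quadratic_contact_with_axis
    (U : R * R -> Prop) (X : R * R -> R * R) (u0 : R) : Prop :=
  exists (lambda : R) (h : R -> R),
    lambda <> 0 /\
    is_domin (locally u0) (fun u => (u - u0) ^ 2)
                          (fun u => h u - lambda * (u - u0) ^ 2) /\
    forall (g : curve) (t : R),
      integral_curve U X g -> dom g t -> pos g t = (u0, 0) ->
      locally t (fun s => snd (pos g s) = h (fst (pos g s))) /\
      locally u0 (fun u => exists s, dom g s /\ pos g s = (u, h u)).

Definition square (u0 eps : R) (w : R * R) : Prop :=
  Rabs (fst w - u0) < eps /\ Rabs (snd w) < eps.

(* Main.v *)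
Require Import Defs.
From Stdlib Require Import Reals Lra Lia.
From Coquelicot Require Import Coquelicot.
Open Scope R_scope.

(** Along the curve [v = 0] of umbilic points the frame [(x_u, x_v, n)] is
    orthonormal and [dN = -k Id], that is [n_u = -k x_u] and [n_v = -k x_v].
    Differentiating the second relation along the curve and exchanging the
    partial derivatives gives [n_uv = -k' x_v - k x_uv].  By the Weingarten
    formulas [e = -x_u . n_u] and [f = -x_v . n_u], this determines the normal
    derivatives [e_v = k E_v] and [f_v = k F_v + k'], while the Taylor expansion
    of the chart gives [g_v = a] and [G_v = 0].  Hence the three coefficients of
    the equation of the curvature lines vanish on [v = 0] with normal derivatives
    [-k'], [a] and [k'] ([divided_coefficients]), and the divided equation
    restricts there to [-k' dv^2 + a du dv + k' du^2 = 0], with discriminant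
    [a^2 + 4 k'^2 > 0].

    Write the divided equation as [l dv^2 + m du dv + p du^2 = 0].  Its
    coefficients are Lipschitz near the axis ([div_v_lipschitz_near]).  If
    [w = m + s] and [s = +- sqrt (m^2 - 4 l p)] has the sign which makes [w <> 0],
    the two solution directions are spanned by [(-2 l, w)] and [(w, -2 p)]
    ([quadratic_line_fields]).  The first field is a graph over the [v]-axis and
    the second one a graph over the [u]-axis, both with a Lipschitz slope, so
    that scalar Picard-Lindelof theory yields the two foliations
    ([foliation_of_slope], the first field after exchanging the coordinates).

    The first field has nonzero second component: it is transversal to the axis.
    The second component of the second field is [-2 k'] on the axis.  If
    [k'(u0) <> 0] it is transversal as well.  If [k'(u0) = 0], its leaf through
    [(u0, 0)] solves [h' = -2 p (u, h) / w (u, h)], whose right-hand side is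
    [-2 k''(u0) / w (u0, 0) * (u - u0) + o (u - u0)] along the leaf, and
    integrating gives the quadratic contact ([quadratic_contact_of_slope]). *)

(** * Scalar differential equations with a Lipschitz slope *)

(** One constant serves both as a bound and as a Lipschitz constant. Slopes
    satisfying this on the whole plane make the solutions of [y' = f x y] exist
    with no constraint on their domain; clamping the arguments to a square
    turns a locally Lipschitz function into one of these. *)
Definition bounded_lipschitz (f : R -> R -> R) : Prop :=
  exists K, forall x y x' y',
    Rabs (f x y) <= K /\
    Rabs (f x y - f x' y') <= K * (Rabs (x - x') + Rabs (y - y')).

Lemma derive_bound (f df : R -> R) (a e C b : R) :
  (forall c, Rabs (c - a) <= e -> is_derive f c (df c)) ->
  (forall c, Rabs (c - a) <= e -> Rabs (df c) <= C) ->
  Rabs (b - a) <= e -> Rabs (f b - f a) <= C * Rabs (b - a).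
Proof.
  intros Hd HC Hb.
  destruct (MVT_cor4 f df a e Hd b Hb) as [c [-> Hc]].
  rewrite Rabs_mult.
  apply Rmult_le_compat_r; [apply Rabs_pos | apply HC; lra].
Qed.

Lemma half_pow_small (C : R) (eps : posreal) :
  exists n0, forall n, (n0 <= n)%nat -> C * (1 / 2) ^ n < eps.
Proof.
  assert (Hl : is_lim_seq (fun n => C * (1 / 2) ^ n) 0).
  { evar_last.
    - apply is_lim_seq_scal_l, is_lim_seq_geom. rewrite Rabs_pos_eq; lra.
    - simpl. f_equal. ring. }
  apply is_lim_seq_spec in Hl. destruct (Hl eps) as [n0 Hn].
  exists n0. intros n Hle. specialize (Hn n Hle). apply Rabs_def2 in Hn. lra.
Qed.

(** How the uniqueness statements below conclude: a quantity that survives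
    arbitrarily many halvings is zero. *)
Lemma zero_of_half_pow (C d : R) :
  (forall n, Rabs d <= C * (1 / 2) ^ n) -> d = 0.
Proof.
  intros H. apply Rabs_eq_0.
  destruct (Rle_lt_or_eq_dec 0 (Rabs d) (Rabs_pos d)) as [Hlt | ]; [ | congruence].
  destruct (half_pow_small C (mkposreal _ Hlt)) as [n Hn].
  specialize (Hn n (le_n n)). specialize (H n). simpl in Hn. lra.
Qed.

Lemma lipschitz_continuous (h : R -> R) (K : R) :
  (forall x x', Rabs (h x - h x') <= K * Rabs (x - x')) ->
  forall x, continuous h x.
Proof.
  intros H x. apply filterlim_locally. intros eps.
  assert (HK : 0 < Rabs K + 1) by (pose proof (Rabs_pos K); lra).
  exists (mkposreal _ (Rdiv_lt_0_compat _ _ (cond_pos eps) HK)).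
  intros z Hz. cbv [ball AbsRing_ball] in *; simpl in *.
  unfold AbsRing_ball, abs, minus, plus, opp in *; simpl in *.
  apply Rle_lt_trans with (1 := H z x). fold (z - x) in Hz.
  apply Rlt_div_r in Hz; [ | lra].
  apply Rle_lt_trans with (2 := Hz).
  rewrite Rmult_comm. apply Rmult_le_compat_l; [apply Rabs_pos | ].
  pose proof (Rle_abs K). lra.
Qed.

Definition clamp (c e x : R) : R := Rmax (c - e) (Rmin (c + e) x).

Lemma clamp_id (c e x : R) : Rabs (x - c) <= e -> clamp c e x = x.
Proof.
  intros H. apply Rabs_le_between in H. unfold clamp.
  rewrite Rmin_right, Rmax_right; lra.
Qed.

Lemma clamp_close (c e x : R) : 0 <= e -> Rabs (clamp c e x - c) <= e.
Proof.
  intros He. apply Rabs_le. unfold clamp, Rmax, Rmin.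
  destruct (Rle_dec (c + e) x); destruct (Rle_dec _ _); lra.
Qed.

Lemma clamp_lipschitz (c e x x' : R) :
  Rabs (clamp c e x - clamp c e x') <= Rabs (x - x').
Proof.
  unfold clamp, Rmax, Rmin.
  destruct (Rle_dec (c + e) x); destruct (Rle_dec (c + e) x');
    repeat destruct (Rle_dec _ _); unfold Rabs; repeat destruct (Rcase_abs _);
    lra.
Qed.

Section Solution.

Variables (f : R -> R -> R) (K : R).
Hypothesis Hf : forall x y x' y',
    Rabs (f x y) <= K /\
    Rabs (f x y - f x' y') <= K * (Rabs (x - x') + Rabs (y - y')).

Lemma slope_constant_nonneg : 0 <= K.
Proof.
  destruct (Hf 0 0 0 0) as [H _]. pose proof (Rabs_pos (f 0 0)). lra.
Qed.

Lemma slope_along_graph_continuous (h : R -> R) (x : R) :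
  continuous h x -> continuous (fun s => f s (h s)) x.
Proof.
  intros Hh. apply filterlim_locally. intros eps.
  pose proof slope_constant_nonneg as HK.
  assert (He : 0 < eps / (2 * (K + 1))).
  { apply Rdiv_lt_0_compat; [apply cond_pos | lra]. }
  pose (e := mkposreal _ He).
  assert (Hx : locally x (fun s => Rabs (s - x) < e)) by (exists e; tauto).
  assert (Hy : locally x (fun s => Rabs (h s - h x) < e)).
  { apply filterlim_locally with (eps := e) in Hh. exact Hh. }
  generalize (filter_and _ _ Hx Hy). apply filter_imp. intros s [H1 H2].
  change (Rabs (f s (h s) - f x (h x)) < eps).
  apply Rle_lt_trans with (1 := proj2 (Hf s (h s) x (h x))).
  apply Rle_lt_trans with ((K + 1) * (Rabs (s - x) + Rabs (h s - h x))).
  { apply Rmult_le_compat_r; [ | lra].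
    pose proof (Rabs_pos (s - x)). pose proof (Rabs_pos (h s - h x)). lra. }
  replace (pos eps) with ((K + 1) * (e + e)) by (simpl; field; lra).
  apply Rmult_lt_compat_l; lra.
Qed.

Variables x1 y1 : R.

(** The integral operator whose fixed points are the solutions of [y' = f x y]
    through [(x1, y1)]. *)
Definition picard_step (h : R -> R) (x : R) : R :=
  y1 + RInt (fun s => f s (h s)) x1 x.

Lemma picard_step_init (h : R -> R) : picard_step h x1 = y1.
Proof. unfold picard_step. rewrite RInt_point. apply Rplus_0_r. Qed.

Lemma picard_step_derive (h : R -> R) :
  (forall x, continuous h x) ->
  forall x, is_derive (picard_step h) x (f x (h x)).
Proof.
  intros Hh x.
  assert (Hc : forall s, continuous (fun s => f s (h s)) s)
    by (intros s; apply slope_along_graph_continuous, Hh).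
  unfold picard_step.
  evar_last.
  - apply @is_derive_plus; [apply is_derive_const | ].
    apply is_derive_RInt with x1; [ | apply Hc].
    apply filter_forall. intros z.
    apply (RInt_correct (V := R_CompleteNormedModule)), ex_RInt_continuous.
    intros s _; apply Hc.
  - apply Rplus_0_l.
Qed.

(** The iterates have slope at most [K], a constant which does not depend on the
    iterate; the limit inherits it, and so is continuous. *)
Lemma picard_step_lipschitz (h : R -> R) :
  (forall x, continuous h x) ->
  forall x x', Rabs (picard_step h x - picard_step h x') <= K * Rabs (x - x').
Proof.
  intros Hh x x'.
  apply derive_bound with (df := fun s => f s (h s)) (e := Rabs (x - x'));
    try lra.
  - intros c _. now apply picard_step_derive.
  - intros c _. apply (Hf c (h c) 0 0).
Qed.

Fixpoint picard (n : nat) : R -> R :=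
  match n with
  | O => fun _ => y1
  | S n => picard_step (picard n)
  end.

Lemma picard_lipschitz (n : nat) :
  forall x x', Rabs (picard n x - picard n x') <= K * Rabs (x - x').
Proof.
  induction n as [ | n IH]; intros x x'.
  - simpl. rewrite Rminus_diag, Rabs_R0.
    apply Rmult_le_pos; [apply slope_constant_nonneg | apply Rabs_pos].
  - apply picard_step_lipschitz, (lipschitz_continuous _ K), IH.
Qed.

Let delta := 1 / (2 * (K + 1)).

Lemma delta_pos : 0 < delta.
Proof.
  unfold delta. pose proof slope_constant_nonneg.
  apply Rdiv_lt_0_compat; lra.
Qed.

Lemma K_delta : K * delta <= 1 / 2.
Proof.
  unfold delta. pose proof slope_constant_nonneg.
  replace (1 / 2) with ((K + 1) * (1 / (2 * (K + 1)))) by (field; lra).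
  apply Rmult_le_compat_r; [ | lra]. apply Rlt_le, delta_pos.
Qed.

(** The derivative of the difference of two images is at most [K C], and the two
    images agree at [x1]; on a neighborhood of size [delta] this halves [C]
    because [K delta <= 1 / 2]. *)
Lemma picard_step_contracts (h h' : R -> R) (C : R) :
  (forall x, continuous h x) -> (forall x, continuous h' x) ->
  (forall x, Rabs (x - x1) <= delta -> Rabs (h x - h' x) <= C) ->
  forall x, Rabs (x - x1) <= delta ->
    Rabs (picard_step h x - picard_step h' x) <= C * (1 / 2).
Proof.
  intros Hh Hh' HC x Hx.
  assert (HC0 : 0 <= C).
  { apply Rle_trans with (2 := HC x Hx), Rabs_pos. }
  replace (picard_step h x - picard_step h' x)
    with ((picard_step h x - picard_step h' x)
          - (picard_step h x1 - picard_step h' x1))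
    by (rewrite !picard_step_init; ring).
  apply Rle_trans with (K * C * Rabs (x - x1)).
  - apply (derive_bound (fun x => picard_step h x - picard_step h' x)
             (fun s => f s (h s) - f s (h' s)) x1 delta); [ | | exact Hx].
    + intros c _. apply @is_derive_minus; now apply picard_step_derive.
    + intros c Hc. apply Rle_trans with (1 := proj2 (Hf _ _ _ _)).
      rewrite Rminus_diag, Rabs_R0, Rplus_0_l.
      apply Rmult_le_compat_l; [apply slope_constant_nonneg | now apply HC].
  - apply Rle_trans with (K * C * delta).
    + apply Rmult_le_compat_l; [ | exact Hx].
      apply Rmult_le_pos; [apply slope_constant_nonneg | exact HC0].
    + replace (K * C * delta) with (C * (K * delta)) by ring.
      apply Rmult_le_compat_l; [exact HC0 | apply K_delta].
Qed.

Lemma picard_continuous (n : nat) (x : R) : continuous (picard n) x.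
Proof. apply (lipschitz_continuous _ K), picard_lipschitz. Qed.

Lemma picard_increment (n : nat) :
  forall x, Rabs (x - x1) <= delta ->
    Rabs (picard (S n) x - picard n x) <= (1 / 2) ^ n.
Proof.
  induction n as [ | n IH]; intros x Hx.
  - simpl.
    apply Rle_trans with (K * Rabs (x - x1)).
    + pose proof (picard_step_lipschitz (fun _ => y1)
                    (fun s => continuous_const y1 s) x x1) as H.
      now rewrite picard_step_init in H.
    + pose proof K_delta. pose proof slope_constant_nonneg.
      assert (K * Rabs (x - x1) <= K * delta)
        by (apply Rmult_le_compat_l; assumption).
      lra.
  - simpl pow. rewrite Rmult_comm.
    apply (picard_step_contracts (picard (S n)) (picard n)); auto;
      apply picard_continuous.
Qed.

(** The increments are dominated by a geometric series of ratio one half, whose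
    tail from [n] on is [2 (1/2)^n]. *)
Lemma picard_cauchy (n p : nat) (x : R) :
  Rabs (x - x1) <= delta ->
  Rabs (picard (p + n) x - picard n x) <= 2 * (1 / 2) ^ n.
Proof.
  intros Hx.
  apply Rle_trans with (2 * (1 / 2) ^ n - 2 * (1 / 2) ^ (p + n)).
  - induction p as [ | p IH].
    + simpl. rewrite Rminus_diag, Rabs_R0. lra.
    + replace (picard (S p + n) x - picard n x)
        with ((picard (S (p + n)) x - picard (p + n) x)
              + (picard (p + n) x - picard n x)) by (simpl; ring).
      apply Rle_trans with (1 := Rabs_triang _ _).
      pose proof (picard_increment (p + n) x Hx). simpl pow. lra.
  - assert (0 < (1 / 2) ^ (p + n)) by (apply pow_lt; lra). lra.
Qed.

Lemma picard_converges (x : R) :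
  Rabs (x - x1) <= delta -> ex_finite_lim_seq (fun n => picard n x).
Proof.
  intros Hx. apply ex_lim_seq_cauchy_corr. intros eps.
  destruct (half_pow_small 4 eps) as [n0 Hn0].
  exists n0. intros n m Hn Hm.
  specialize (Hn0 n0 (le_n n0)).
  pose proof (picard_cauchy n0 (n - n0) x Hx) as H1.
  pose proof (picard_cauchy n0 (m - n0) x Hx) as H2.
  replace (n - n0 + n0)%nat with n in H1 by lia.
  replace (m - n0 + n0)%nat with m in H2 by lia.
  replace (picard n x - picard m x)
    with ((picard n x - picard n0 x) - (picard m x - picard n0 x)) by ring.
  apply Rle_lt_trans with (1 := Rabs_triang _ _). rewrite Rabs_Ropp. lra.
Qed.

(** The iterates converge only near [x1].  Clamping the argument extends the
    limit to a continuous function on the line, to which [picard_step] applies. *)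
Definition picard_limit (x : R) : R :=
  real (Lim_seq (fun n => picard n (clamp x1 delta x))).

Lemma picard_limit_close (n : nat) (x : R) :
  Rabs (x - x1) <= delta ->
  Rabs (picard_limit x - picard n x) <= 2 * (1 / 2) ^ n.
Proof.
  intros Hx. unfold picard_limit. rewrite clamp_id by exact Hx.
  pose proof (Lim_seq_correct' _ (picard_converges x Hx)) as Hl.
  assert (Hl' : is_lim_seq (fun p => Rabs (picard (p + n) x - picard n x))
                  (Rabs (real (Lim_seq (fun n => picard n x)) - picard n x))).
  { apply (is_lim_seq_abs _ (Finite _)).
    apply is_lim_seq_minus'; [ | apply is_lim_seq_const].
    apply is_lim_seq_incr_n with (N := n) in Hl. exact Hl. }
  refine (is_lim_seq_le _ (fun _ => 2 * (1 / 2) ^ n) (Finite _) (Finite _)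
            _ Hl' (is_lim_seq_const _)).
  intros p. now apply picard_cauchy.
Qed.

Lemma picard_limit_lipschitz (x x' : R) :
  Rabs (picard_limit x - picard_limit x') <= K * Rabs (x - x').
Proof.
  pose proof (clamp_close x1 delta x (Rlt_le _ _ delta_pos)) as Hx.
  pose proof (clamp_close x1 delta x' (Rlt_le _ _ delta_pos)) as Hx'.
  pose proof (Lim_seq_correct' _ (picard_converges _ Hx)) as Hl.
  pose proof (Lim_seq_correct' _ (picard_converges _ Hx')) as Hl'.
  refine (is_lim_seq_le _ (fun _ => K * Rabs (x - x')) (Finite _) (Finite _) _
            (is_lim_seq_abs _ (Finite _) (is_lim_seq_minus' _ _ _ _ Hl Hl'))
            (is_lim_seq_const _)).
  intros n. simpl. apply Rle_trans with (1 := picard_lipschitz n _ _).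
  apply Rmult_le_compat_l; [apply slope_constant_nonneg | apply clamp_lipschitz].
Qed.

Lemma picard_limit_continuous (x : R) : continuous picard_limit x.
Proof. apply (lipschitz_continuous _ K), picard_limit_lipschitz. Qed.

(** Both sides are within a constant times [(1/2)^n] of the same iterate. *)
Lemma picard_limit_fixed (x : R) :
  Rabs (x - x1) <= delta -> picard_step picard_limit x = picard_limit x.
Proof.
  intros Hx. apply Rminus_diag_uniq, (zero_of_half_pow 2). intros n.
  replace (picard_step picard_limit x - picard_limit x)
    with ((picard_step picard_limit x - picard (S n) x)
          - (picard_limit x - picard (S n) x)) by ring.
  apply Rle_trans with (1 := Rabs_triang _ _). rewrite Rabs_Ropp.
  pose proof (picard_limit_close (S n) x Hx) as H1. simpl pow in H1.
  pose proof (picard_step_contracts picard_limit (picard n) (2 * (1 / 2) ^ n)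
                picard_limit_continuous (picard_continuous n)
                (picard_limit_close n) x Hx) as H2.
  change (picard (S n)) with (picard_step (picard n)) in *.
  lra.
Qed.

End Solution.

(** Local existence of Picard-Lindelof.  The solution is the image of the limit
    under the integral operator, as this image is differentiable at the end
    points too. *)
Lemma local_solution (f : R -> R -> R) (x1 y1 : R) :
  bounded_lipschitz f ->
  exists (delta : R) (h : R -> R), 0 < delta /\ h x1 = y1 /\
    forall x, Rabs (x - x1) <= delta -> is_derive h x (f x (h x)).
Proof.
  intros [K Hf].
  exists (1 / (2 * (K + 1))), (picard_step f x1 y1 (picard_limit f K x1 y1)).
  split; [ | split].
  - apply (delta_pos f K Hf).
  - apply picard_step_init.
  - intros x Hx. rewrite (picard_limit_fixed f K Hf) by exact Hx.
    apply (picard_step_derive f K Hf).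
    apply (picard_limit_continuous f K Hf).
Qed.

(** * Leaves of a line field with a Lipschitz slope *)

Lemma locally_abs (P : R -> Prop) (x : R) :
  locally x P <-> exists d, 0 < d /\ forall y, Rabs (y - x) <= d -> P y.
Proof.
  split.
  - intros [e He]. exists (e / 2). pose proof (cond_pos e).
    split; [lra | ]. intros y Hy. apply He.
    change (Rabs (y - x) < e). lra.
  - intros [d [Hd H]]. exists (mkposreal d Hd). intros y Hy. apply H.
    apply Rlt_le, Hy.
Qed.

Lemma continuous_near (x : R -> R) (t e : R) :
  continuous x t -> 0 < e -> locally t (fun s => Rabs (x s - x t) < e).
Proof.
  intros Hx He.
  exact (proj1 (filterlim_locally x (x t)) Hx (mkposreal e He)).
Qed.

(** Gronwall's uniqueness argument: near [t] the function is bounded by 1, and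
    each integration of [|d'| <= C |d|] over a length at most [1 / (2 |C|)]
    halves the bound. *)
Lemma locally_zero_of_derive_le (d d' : R -> R) (t C : R) :
  d t = 0 -> locally t (fun s => is_derive d s (d' s)) ->
  locally t (fun s => Rabs (d' s) <= C * Rabs (d s)) ->
  locally t (fun s => d s = 0).
Proof.
  intros H0 Hd Hb.
  assert (Hc : continuous d t).
  { apply (ex_derive_continuous d). exists (d' t). exact (locally_singleton _ _ Hd). }
  pose proof (continuous_near d t 1 Hc Rlt_0_1) as H1.
  destruct (proj1 (locally_abs _ _) (filter_and _ _ Hd (filter_and _ _ Hb H1)))
    as [e [He H]].
  pose (e' := Rmin e (1 / (2 * (Rabs C + 1)))).
  pose proof (Rabs_pos C) as HC.
  assert (He1 : e' <= e) by apply Rmin_l.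
  assert (He0 : 0 < e').
  { apply Rmin_glb_lt; [exact He | apply Rdiv_lt_0_compat; lra]. }
  assert (He2 : Rabs C * e' <= 1 / 2).
  { apply Rle_trans with ((Rabs C + 1) * (1 / (2 * (Rabs C + 1)))).
    - apply Rmult_le_compat; [lra | lra | lra | apply Rmin_r].
    - apply Req_le. field. lra. }
  apply locally_abs. exists e'. split; [exact He0 | ].
  intros s Hs. apply (zero_of_half_pow 1). intros n. revert s Hs.
  induction n as [ | n IH]; intros s Hs.
  - destruct (H s ltac:(lra)) as [_ [_ Hs1]].
    rewrite H0, Rminus_0_r in Hs1. simpl. lra.
  - replace (d s) with (d s - d t) by (rewrite H0; ring).
    apply Rle_trans with (Rabs C * (1 / 2) ^ n * Rabs (s - t)).
    + apply derive_bound with (df := d') (e := e'); [ | | exact Hs].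
      * intros c Hc'. apply H. lra.
      * intros c Hc'. apply Rle_trans with (C * Rabs (d c)).
        { apply H. lra. }
        apply Rle_trans with (Rabs C * Rabs (d c)).
        { apply Rmult_le_compat_r; [apply Rabs_pos | apply Rle_abs]. }
        apply Rmult_le_compat_l; [exact HC | ].
        specialize (IH c Hc'). lra.
    + assert (0 < (1 / 2) ^ n) by (apply pow_lt; lra).
      simpl pow. apply Rle_trans with ((1 / 2) ^ n * (Rabs C * e')).
      * rewrite (Rmult_comm (Rabs C)), Rmult_assoc.
        apply Rmult_le_compat_l; [lra | ].
        apply Rmult_le_compat_l; assumption.
      * replace (1 * (1 / 2 * (1 / 2) ^ n)) with ((1 / 2) ^ n * (1 / 2)) by ring.
        apply Rmult_le_compat_l; lra.
Qed.

(** Differentiability as a first order expansion with explicit inequalities. *)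
Lemma is_derive_linear (f : R -> R) (x l : R) :
  is_derive f x l <->
  (forall eps, 0 < eps ->
     locally x (fun y => Rabs (f y - f x - l * (y - x)) <= eps * Rabs (y - x))).
Proof.
  assert (E : forall y, norm (minus (minus (f y) (f x)) (scal (minus y x) l))
                        = Rabs (f y - f x - l * (y - x))).
  { intros y. change (Rabs (f y - f x - (y - x) * l)
                      = Rabs (f y - f x - l * (y - x))).
    f_equal. ring. }
  split.
  - intros [_ H] eps Heps.
    specialize (H x (fun P HP => HP) (mkposreal eps Heps)).
    revert H. apply filter_imp. intros y Hy. rewrite <- E. exact Hy.
  - intros H. split; [apply is_linear_scal_l | ].
    intros z Hz.
    rewrite <- (is_filter_lim_locally_unique (V := R_NormedModule) x z Hz).
    intros eps. specialize (H eps (cond_pos eps)).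
    revert H. apply filter_imp. intros y Hy. rewrite E. exact Hy.
Qed.

(** A nonzero derivative at one point is enough for the image to be a
    neighborhood: the function is above its value on one side and below on the
    other, and the intermediate value theorem fills the gap.  The predicate [P]
    records where the preimages can be taken. *)
Lemma image_near_pos (x : R -> R) (t l : R) (P : R -> Prop) :
  is_derive x t l -> 0 < l -> locally t (continuous x) -> locally t P ->
  locally (x t) (fun z => exists s, P s /\ x s = z).
Proof.
  intros Hx Hl Hc HP.
  assert (Hlin : locally t (fun s =>
            Rabs (x s - x t - l * (s - t)) <= l / 2 * Rabs (s - t))).
  { apply (proj1 (is_derive_linear x t l) Hx). lra. }
  destruct (proj1 (locally_abs _ _) (filter_and _ _ Hlin (filter_and _ _ Hc HP)))
    as [e [He H]].
  assert (Hlo : x (t - e) < x t).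
  { destruct (H (t - e)) as [H1 _].
    { replace (t - e - t) with (- e) by ring. rewrite Rabs_Ropp, Rabs_pos_eq; lra. }
    replace (t - e - t) with (- e) in H1 by ring.
    rewrite Rabs_Ropp, (Rabs_pos_eq e) in H1 by lra.
    apply Rabs_le_between in H1. nra. }
  assert (Hhi : x t < x (t + e)).
  { destruct (H (t + e)) as [H1 _].
    { replace (t + e - t) with e by ring. rewrite Rabs_pos_eq; lra. }
    replace (t + e - t) with e in H1 by ring.
    rewrite (Rabs_pos_eq e) in H1 by lra.
    apply Rabs_le_between in H1. nra. }
  apply locally_abs.
  exists (Rmin (x t - x (t - e)) (x (t + e) - x t) / 2).
  assert (Hm : 0 < Rmin (x t - x (t - e)) (x (t + e) - x t))
    by (apply Rmin_glb_lt; lra).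
  split; [lra | ]. intros z Hz. apply Rabs_le_between in Hz.
  pose proof (Rmin_l (x t - x (t - e)) (x (t + e) - x t)).
  pose proof (Rmin_r (x t - x (t - e)) (x (t + e) - x t)).
  destruct (Ranalysis5.IVT_interv (fun s => x s - z) (t - e) (t + e))
    as [s [Hs Hsz]]; try lra.
  - intros s Hs. apply continuity_pt_minus.
    + apply continuity_pt_filterlim. apply H. apply Rabs_le. lra.
    + apply continuity_pt_const. now intros ? ?.
  - exists s. split; [ | lra]. apply H. apply Rabs_le. lra.
Qed.

Lemma image_near (x : R -> R) (t l : R) (P : R -> Prop) :
  is_derive x t l -> l <> 0 -> locally t (continuous x) -> locally t P ->
  locally (x t) (fun z => exists s, P s /\ x s = z).
Proof.
  intros Hx Hl Hc HP.
  destruct (Rlt_le_dec 0 l) as [Hpos | Hneg].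
  - now apply image_near_pos with l.
  - assert (H : locally (- x t) (fun z => exists s, P s /\ - x s = z)).
    { apply (image_near_pos (fun s => - x s) t (- l)); [ | lra | | exact HP].
      - now apply @is_derive_opp.
      - revert Hc. apply filter_imp. intros s. apply (continuous_opp x). }
    apply locally_abs in H. destruct H as [d [Hd H]].
    apply locally_abs. exists d. split; [exact Hd | ]. intros z Hz.
    destruct (H (- z)) as [s [HPs Hs]].
    { replace (- z - - x t) with (- (z - x t)) by ring. now rewrite Rabs_Ropp. }
    exists s. split; [exact HPs | lra].
Qed.

Lemma continuous_pair_intro {T U V : UniformSpace} (f : T -> U) (g : T -> V) (t : T) :
  continuous f t -> continuous g t -> continuous (fun s => (f s, g s)) t.
Proof.
  intros Hf Hg P [e HP].
  pose proof (Hf _ (locally_ball (f t) e)) as H1.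
  pose proof (Hg _ (locally_ball (g t) e)) as H2.
  unfold filtermap in *. generalize (filter_and _ _ H1 H2).
  apply filter_imp. intros s Hs. apply HP. exact Hs.
Qed.

Lemma dom_locally (g : curve) (t : R) : dom g t -> locally t (dom g).
Proof.
  intros [H1 H2].
  apply filter_and; [apply (open_gt (lo g)) | apply (open_lt (hi g))]; assumption.
Qed.

(** The line field spanned by [X] is that of the graphs [y = h x] with
    [h' = f x h]. *)
Definition has_slope (U : R * R -> Prop) (X : R * R -> R * R) (f : R -> R -> R)
    : Prop :=
  forall w, U w -> fst (X w) <> 0 /\ snd (X w) = f (fst w) (snd w) * fst (X w).

Section Leaves.

Variables (U : R * R -> Prop) (X : R * R -> R * R) (f : R -> R -> R).
Hypothesis Hslope : has_slope U X f.
Hypothesis Hf : bounded_lipschitz f.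

(** Since the first component of [X] does not vanish, neither does that of a
    nonzero parallel vector. *)
Lemma integral_curve_slope (g : curve) (t : R) :
  integral_curve U X g -> dom g t ->
  fst (velocity g t) <> 0 /\
  snd (velocity g t) = f (fst (Defs.pos g t)) (snd (Defs.pos g t)) * fst (velocity g t).
Proof.
  intros Hg Ht. destruct (Hg t Ht) as [HU [_ [_ [_ [Hv Hp]]]]].
  destruct (Hslope _ HU) as [H1 H2].
  unfold parallel in Hp. rewrite H2 in Hp.
  assert (E : snd (velocity g t)
              = f (fst (Defs.pos g t)) (snd (Defs.pos g t)) * fst (velocity g t)).
  { apply Rmult_eq_reg_r with (fst (X (Defs.pos g t))); [lra | exact H1]. }
  split; [ | exact E]. intros H0. apply Hv.
  rewrite (surjective_pairing (velocity g t)), E, H0, Rmult_0_r. reflexivity.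
Qed.

(** An integral curve need not be parametrized by [x], so it is compared with
    the graph of a solution [h] through the difference [y - h x], which vanishes
    at [t] and whose derivative is [x'] times the difference of two values of
    the slope.  Conversely the abscissa of the curve has nonzero derivative, and
    so it covers a neighborhood of [x1]. *)
Lemma integral_curve_in_graph (g : curve) (t x1 delta : R) (h : R -> R) :
  integral_curve U X g -> dom g t -> 0 < delta -> Defs.pos g t = (x1, h x1) ->
  (forall x, Rabs (x - x1) <= delta -> is_derive h x (f x (h x))) ->
  locally t (fun s => snd (Defs.pos g s) = h (fst (Defs.pos g s))) /\
  (forall P : R -> Prop, locally t P ->
     locally x1 (fun x => exists s, P s /\ dom g s /\ Defs.pos g s = (x, h x))).
Proof.
  intros Hg Ht Hdelta Hpos Hh.
  destruct Hf as [K HK].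
  pose (x := fun s => fst (Defs.pos g s)). pose (y := fun s => snd (Defs.pos g s)).
  assert (Hx1 : x t = x1) by (unfold x; now rewrite Hpos).
  assert (Hy1 : y t = h x1) by (unfold y; now rewrite Hpos).
  assert (Hdx : forall s, dom g s -> is_derive x s (fst (velocity g s))).
  { intros s Hs. apply Derive_correct. now apply (Hg s Hs). }
  assert (Hdy : forall s, dom g s -> is_derive y s (snd (velocity g s))).
  { intros s Hs. apply Derive_correct. now apply (Hg s Hs). }
  assert (Hcx : forall s, dom g s -> continuous x s).
  { intros s Hs. apply (ex_derive_continuous x). eexists. now apply Hdx. }
  pose proof (dom_locally g t Ht) as Hloc.
  assert (Hclose : locally t (fun s => Rabs (x s - x1) < delta)).
  { rewrite <- Hx1. apply continuous_near; auto. }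
  assert (Hspeed : locally t (fun s =>
            Rabs (fst (velocity g s)) <= Rabs (fst (velocity g t)) + 1)).
  { assert (Hc : continuous (fun s => fst (velocity g s)) t).
    { apply (continuous_comp (velocity g) fst); [now apply (Hg t Ht) | ].
      rewrite (surjective_pairing (velocity g t)). apply continuous_fst. }
    generalize (continuous_near _ t 1 Hc Rlt_0_1). apply filter_imp.
    intros s Hs.
    pose proof (Rabs_triang_inv (fst (velocity g s)) (fst (velocity g t))). lra. }
  assert (Hgraph : locally t (fun s => y s - h (x s) = 0)).
  { apply (locally_zero_of_derive_le (fun s => y s - h (x s))
             (fun s => snd (velocity g s) - fst (velocity g s) * f (x s) (h (x s)))
             t ((Rabs (fst (velocity g t)) + 1) * K)).
    - rewrite Hx1, Hy1. ring.
    - generalize (filter_and _ _ Hloc Hclose). apply filter_imp.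
      intros s [Hs Hs']. apply @is_derive_minus; [now apply Hdy | ].
      apply (is_derive_comp h x); [apply Hh; lra | now apply Hdx].
    - generalize (filter_and _ _ Hloc Hspeed). apply filter_imp.
      intros s [Hs Hs'].
      rewrite (proj2 (integral_curve_slope g s Hg Hs)).
      fold (x s) (y s).
      replace (f (x s) (y s) * fst (velocity g s)
               - fst (velocity g s) * f (x s) (h (x s)))
        with (fst (velocity g s) * (f (x s) (y s) - f (x s) (h (x s)))) by ring.
      rewrite Rabs_mult, Rmult_assoc.
      apply Rmult_le_compat; [apply Rabs_pos | apply Rabs_pos | exact Hs' | ].
      apply Rle_trans with (1 := proj2 (HK _ _ _ _)).
      rewrite Rminus_diag, Rabs_R0, Rplus_0_l. lra. }
  split.
  - revert Hgraph. apply filter_imp. unfold x, y. intros s Hs. lra.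
  - intros P HP. rewrite <- Hx1.
    assert (Hc : locally t (continuous x)).
    { revert Hloc. apply filter_imp. exact Hcx. }
    pose proof (image_near x t _ _ (Hdx t Ht)
                  (proj1 (integral_curve_slope g t Hg Ht)) Hc
                  (filter_and _ _ HP (filter_and _ _ Hloc Hgraph))) as Hi.
    revert Hi. apply filter_imp. intros z [s [[HPs [Hs Hys]] Hz]].
    exists s. repeat split; try assumption; try apply Hs.
    rewrite (surjective_pairing (Defs.pos g s)). fold (x s) (y s).
    now rewrite <- Hz, (Rminus_diag_uniq _ _ Hys).
Qed.

Lemma graph_integral_curve (x1 y1 : R) :
  open U -> U (x1, y1) ->
  exists (g : curve) (t : R), integral_curve U X g /\ dom g t /\ Defs.pos g t = (x1, y1).
Proof.
  intros HU Hw.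
  destruct (local_solution f x1 y1 Hf) as [delta [h [Hdelta [Hh1 Hh]]]].
  assert (Hch : forall x, Rabs (x - x1) <= delta -> continuous h x).
  { intros x Hx. apply (ex_derive_continuous h). eexists. now apply Hh. }
  assert (Hin : locally x1 (fun x => U (x, h x))).
  { assert (Hc : continuous (fun x => (x, h x)) x1).
    { apply continuous_pair_intro; [apply continuous_id | apply Hch].
      rewrite Rminus_diag, Rabs_R0; lra. }
    apply Hc. simpl. rewrite Hh1. now apply HU. }
  apply locally_abs in Hin. destruct Hin as [e [He Hin]].
  pose (r := Rmin e delta).
  assert (Hr : 0 < r) by (apply Rmin_glb_lt; assumption).
  assert (Hre : r <= e) by apply Rmin_l.
  assert (Hrd : r <= delta) by apply Rmin_r.
  exists (Curve (x1 - r) (x1 + r) (fun x => (x, h x))), x1.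
  assert (Hvel : forall s, Rabs (s - x1) <= r ->
            velocity (Curve (x1 - r) (x1 + r) (fun x => (x, h x))) s
            = (1, f s (h s))).
  { intros s Hs. unfold velocity; simpl. f_equal.
    - apply Derive_id.
    - apply is_derive_unique, Hh. lra. }
  split; [ | split].
  - intros s Hs. unfold dom in Hs; simpl in Hs.
    assert (Hs' : Rabs (s - x1) < r) by (apply Rabs_lt_between; lra).
    simpl. rewrite Hvel by lra. simpl.
    assert (HUs : U (s, h s)) by (apply Hin; lra).
    destruct (Hslope _ HUs) as [H1 H2]. simpl in H2.
    repeat split.
    + exact HUs.
    + apply ex_derive_id.
    + eexists. apply Hh. lra.
    + apply continuous_ext_loc with (fun s => (1, f s (h s))).
      * pose proof (dom_locally (Curve (x1 - r) (x1 + r) (fun x => (x, h x))) s Hs)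
          as Hd.
        revert Hd. apply filter_imp. intros z Hz. unfold dom in Hz; simpl in Hz.
        symmetry. apply Hvel. apply Rabs_le. lra.
      * apply continuous_pair_intro; [apply continuous_const | ].
        destruct Hf as [K HK].
        apply (slope_along_graph_continuous f K HK). apply Hch. lra.
    + intros E. injection E. intros. lra.
    + unfold parallel; simpl. rewrite H2. ring.
  - unfold dom; simpl; lra.
  - simpl. now rewrite Hh1.
Qed.

(** Two integral curves through a point lie, near it, in the graph of one and
    the same solution, and each of them covers this graph near the point. *)
Lemma foliation_of_slope :
  open U -> (forall w, U w -> continuous X w) -> foliation U X.
Proof.
  intros HU HX. split; [ | split].
  - intros w Hw. split; [now apply HX | ]. intros E.
    apply (proj1 (Hslope w Hw)). now rewrite E.
  - intros [x1 y1] Hw. now apply graph_integral_curve.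
  - intros g g' t t' Hg Hg' Ht Ht' E.
    destruct (Defs.pos g t) as [x1 y1] eqn:Hpos. symmetry in E.
    destruct (local_solution f x1 y1 Hf) as [delta [h [Hdelta [Hh1 Hh]]]].
    rewrite <- Hh1 in Hpos, E.
    destruct (integral_curve_in_graph g t x1 delta h Hg Ht Hdelta Hpos Hh)
      as [H1 _].
    destruct (integral_curve_in_graph g' t' x1 delta h Hg' Ht' Hdelta E Hh)
      as [_ H2].
    specialize (H2 (fun _ => True) filter_true).
    assert (Hc : continuous (fun s => fst (Defs.pos g s)) t).
    { apply (ex_derive_continuous (fun s => fst (Defs.pos g s))). now apply (Hg t Ht). }
    assert (H3 : locally t (fun s => exists s', True /\ dom g' s' /\
               Defs.pos g' s' = (fst (Defs.pos g s), h (fst (Defs.pos g s))))).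
    { refine (Hc (fun x => exists s', True /\ dom g' s' /\
                               Defs.pos g' s' = (x, h x)) _).
      rewrite Hpos. exact H2. }
    generalize (filter_and _ _ H1 H3). apply filter_imp.
    intros s [Hs [s' [_ [Hs' Hp]]]]. exists s'. split; [exact Hs' | ].
    rewrite Hp, <- Hs. symmetry. apply surjective_pairing.
Qed.

End Leaves.

(** * Exchange of the coordinates *)

Definition swap (w : R * R) : R * R := (snd w, fst w).

Lemma swapK (w : R * R) : swap (swap w) = w.
Proof. now destruct w. Qed.

Definition swap_curve (g : curve) : curve :=
  Curve (lo g) (hi g) (fun t => swap (Defs.pos g t)).

Lemma continuous_swap (w : R * R) : continuous swap w.
Proof.
  unfold swap. apply continuous_pair_intro; destruct w;
    [apply continuous_snd | apply continuous_fst].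
Qed.

Lemma integral_curve_swap (U : R * R -> Prop) (X : R * R -> R * R) (g : curve) :
  integral_curve (fun w => U (swap w)) (fun w => swap (X (swap w))) g ->
  integral_curve U X (swap_curve g).
Proof.
  intros Hg t Ht. destruct (Hg t Ht) as [HU [Hx [Hy [Hv [Hv0 Hp]]]]].
  repeat split.
  - exact HU.
  - exact Hy.
  - exact Hx.
  - apply (continuous_comp (velocity g) swap); [exact Hv | apply continuous_swap].
  - intros E. apply Hv0. injection E. intros E1 E2. unfold velocity. now f_equal.
  - unfold parallel in *. simpl in *. lra.
Qed.

Lemma integral_curve_ext (U U' : R * R -> Prop) (X X' : R * R -> R * R) (g : curve) :
  (forall w, U w -> U' w /\ X w = X' w) ->
  integral_curve U X g -> integral_curve U' X' g.
Proof.
  intros HE Hg t Ht. destruct (Hg t Ht) as [HU Hr].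
  destruct (HE _ HU) as [HU' EX]. rewrite <- EX. now split.
Qed.

Lemma integral_curve_unswap (U : R * R -> Prop) (X : R * R -> R * R) (g : curve) :
  integral_curve U X g ->
  integral_curve (fun w => U (swap w)) (fun w => swap (X (swap w))) (swap_curve g).
Proof.
  intros Hg. apply integral_curve_swap. revert Hg. apply integral_curve_ext.
  intros w Hw. now rewrite !swapK.
Qed.

(** Exchanging the coordinates reduces a line field which is nowhere horizontal
    to one which is nowhere vertical. *)
Lemma foliation_swap (U : R * R -> Prop) (X : R * R -> R * R) :
  foliation (fun w => U (swap w)) (fun w => swap (X (swap w))) -> foliation U X.
Proof.
  intros [H1 [H2 H3]]. split; [ | split].
  - intros w Hw. destruct (H1 (swap w)) as [Hc H0]; [now rewrite swapK | ].
    rewrite swapK in H0. split.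
    + apply continuous_ext with (fun w => swap (swap (X (swap (swap w))))).
      { intros z. now rewrite !swapK. }
      apply (continuous_comp (fun w => swap (X (swap (swap w)))) swap);
        [ | apply continuous_swap].
      apply (continuous_comp swap (fun w => swap (X (swap w))));
        [apply continuous_swap | exact Hc].
    + intros E. apply H0. now rewrite E.
  - intros w Hw. destruct (H2 (swap w)) as [g [t [Hg [Ht E]]]];
      [now rewrite swapK | ].
    exists (swap_curve g), t. split; [now apply integral_curve_swap | ].
    split; [exact Ht | ]. simpl. now rewrite E, swapK.
  - intros g g' t t' Hg Hg' Ht Ht' E.
    destruct (H3 (swap_curve g) (swap_curve g') t t'
                (integral_curve_unswap _ _ _ Hg) (integral_curve_unswap _ _ _ Hg')
                Ht Ht') as [e He].
    { simpl. now rewrite E. }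
    exists e. intros s Hs. destruct (He s Hs) as [s' [Hs' E']].
    exists s'. split; [exact Hs' | ]. simpl in E'.
    now rewrite <- (swapK (Defs.pos g' s')), E', swapK.
Qed.

(** * Quadratic contact *)

(** The leaf is [h' = f u h] with [h u0 = h' u0 = 0].  So [h u = o (u - u0)], and
    the Lipschitz condition gives
    [h' u = f u 0 + o (u - u0) = 2 lambda (u - u0) + o (u - u0)];
    the mean value theorem integrates this estimate. *)
Lemma quadratic_contact_of_slope (U : R * R -> Prop) (X : R * R -> R * R)
    (f : R -> R -> R) (u0 lambda : R) :
  has_slope U X f -> bounded_lipschitz f -> f u0 0 = 0 ->
  is_derive (fun u => f u 0) u0 (2 * lambda) -> lambda <> 0 ->
  quadratic_contact_with_axis U X u0.
Proof.
  intros Hslope Hf Hf0 Hdf Hlambda.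
  destruct (local_solution f u0 0 Hf) as [delta [h [Hdelta [Hh0 Hh]]]].
  exists lambda, h. split; [exact Hlambda | split].
  - destruct Hf as [K HK].
    pose proof (slope_constant_nonneg f K HK) as HK0.
    intros eps.
    assert (Heps : 0 < eps / 2) by (pose proof (cond_pos eps); lra).
    assert (Heps' : 0 < eps / 2 / (K + 1)) by (apply Rdiv_lt_0_compat; lra).
    assert (Hh1 : is_derive h u0 0).
    { rewrite <- Hf0, <- Hh0. apply Hh. rewrite Rminus_diag, Rabs_R0. lra. }
    pose proof (proj1 (is_derive_linear _ _ _) Hdf _ Heps) as L1.
    pose proof (proj1 (is_derive_linear _ _ _) Hh1 _ Heps') as L2.
    destruct (proj1 (locally_abs _ _) (filter_and _ _ L1 L2)) as [e [He H]].
    assert (Hdev : forall c, Rabs (c - u0) <= e ->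
              Rabs (f c (h c) - 2 * lambda * (c - u0)) <= eps * Rabs (c - u0)).
    { intros c Hc. destruct (H c Hc) as [B1 B2].
      rewrite Hf0, Rminus_0_r in B1. rewrite Hh0, Rmult_0_l, !Rminus_0_r in B2.
      replace (f c (h c) - 2 * lambda * (c - u0))
        with ((f c (h c) - f c 0) + (f c 0 - 2 * lambda * (c - u0))) by ring.
      apply Rle_trans with (1 := Rabs_triang _ _).
      assert (B3 : Rabs (f c (h c) - f c 0) <= eps / 2 * Rabs (c - u0)).
      { apply Rle_trans with (1 := proj2 (HK _ _ _ _)).
        rewrite Rminus_diag, Rabs_R0, Rplus_0_l, Rminus_0_r.
        apply Rle_trans with ((K + 1) * (eps / 2 / (K + 1) * Rabs (c - u0))).
        - apply Rmult_le_compat; [lra | apply Rabs_pos | lra | exact B2].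
        - apply Req_le. field. lra. }
      lra. }
    apply locally_abs. exists (Rmin e delta).
    split; [now apply Rmin_glb_lt | ]. intros u Hu.
    pose proof (Rmin_l e delta). pose proof (Rmin_r e delta).
    change (Rabs (h u - lambda * (u - u0) ^ 2) <= eps * Rabs ((u - u0) ^ 2)).
    replace (h u - lambda * (u - u0) ^ 2)
      with ((h u - lambda * (u - u0) ^ 2) - (h u0 - lambda * (u0 - u0) ^ 2))
      by (rewrite Hh0; ring).
    replace (Rabs ((u - u0) ^ 2)) with (Rabs (u - u0) * Rabs (u - u0))
      by (rewrite <- Rabs_mult; f_equal; ring).
    rewrite <- Rmult_assoc.
    apply (derive_bound (fun u => h u - lambda * (u - u0) ^ 2)
             (fun u => f u (h u) - 2 * lambda * (u - u0)) u0 (Rabs (u - u0)));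
      [ | | lra].
    + intros c Hc. apply @is_derive_minus; [apply Hh; lra | ].
      auto_derive; [trivial | ring].
    + intros c Hc. apply Rle_trans with (1 := Hdev c ltac:(lra)).
      apply Rmult_le_compat_l; [apply Rlt_le, cond_pos | exact Hc].
  - intros g t Hg Ht Hpos. rewrite <- Hh0 in Hpos.
    destruct (integral_curve_in_graph U X f Hslope Hf g t u0 delta h
                Hg Ht Hdelta Hpos Hh) as [H1 H2].
    split; [exact H1 | ].
    specialize (H2 (fun _ => True) filter_true). revert H2.
    apply filter_imp. intros u [s [_ Hs]]. now exists s.
Qed.

(** Where one factor vanishes, the product rule requires only continuity of the
    other one.  The slope of the leaves on the axis is [k'] times a function that
    is only known to be continuous. *)
Lemma is_derive_mult_vanishing (p c : R -> R) (x l : R) :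
  p x = 0 -> is_derive p x l -> continuous c x ->
  is_derive (fun u => p u * c u) x (l * c x).
Proof.
  intros Hp0 Hp Hc. apply is_derive_linear. intros eps Heps.
  pose (A := Rabs l + 1). pose (B := Rabs (c x) + 1).
  assert (HA : 0 < A) by (unfold A; pose proof (Rabs_pos l); lra).
  assert (HB : 0 < B) by (unfold B; pose proof (Rabs_pos (c x)); lra).
  assert (E1 : 0 < eps / (2 * A)) by (apply Rdiv_lt_0_compat; lra).
  assert (E2 : 0 < eps / (2 * B)) by (apply Rdiv_lt_0_compat; lra).
  pose proof (proj1 (is_derive_linear _ _ _) Hp _ E2) as L1.
  pose proof (continuous_near c x _ Hc E1) as L2.
  pose proof (continuous_near c x _ Hc Rlt_0_1) as L3.
  generalize (filter_and _ _ L1 (filter_and _ _ L2 L3)). apply filter_imp.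
  intros y [H1 [H2 H3]]. rewrite Hp0 in *. rewrite Rminus_0_r in H1.
  replace (p y * c y - 0 * c x - l * c x * (y - x))
    with ((p y - l * (y - x)) * c y + l * (c y - c x) * (y - x)) by ring.
  apply Rle_trans with (1 := Rabs_triang _ _). rewrite !Rabs_mult.
  assert (Hcy : Rabs (c y) <= B).
  { unfold B. pose proof (Rabs_triang_inv (c y) (c x)). lra. }
  assert (M1 : Rabs (p y - l * (y - x)) * Rabs (c y)
               <= eps / (2 * B) * Rabs (y - x) * B).
  { apply Rmult_le_compat; auto using Rabs_pos. }
  assert (M2 : Rabs l * Rabs (c y - c x) <= A * (eps / (2 * A))).
  { apply Rmult_le_compat; auto using Rabs_pos; [unfold A; lra | lra]. }
  apply (Rmult_le_compat_r (Rabs (y - x))) in M2; [ | apply Rabs_pos].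
  replace (eps / (2 * B) * Rabs (y - x) * B) with (eps / 2 * Rabs (y - x)) in M1
    by (field; lra).
  replace (A * (eps / (2 * A))) with (eps / 2) in M2 by (field; lra).
  lra.
Qed.

(** * Operations on bounded Lipschitz functions *)

Lemma bounded_lipschitz_const (c : R) : bounded_lipschitz (fun _ _ => c).
Proof.
  exists (Rabs c). intros. split; [lra | ].
  rewrite Rminus_diag, Rabs_R0.
  apply Rmult_le_pos; [apply Rabs_pos | ].
  pose proof (Rabs_pos (x - x')). pose proof (Rabs_pos (y - y')). lra.
Qed.

Lemma bounded_lipschitz_plus (f g : R -> R -> R) :
  bounded_lipschitz f -> bounded_lipschitz g ->
  bounded_lipschitz (fun x y => f x y + g x y).
Proof.
  intros [K HK] [L HL]. exists (K + L). intros x y x' y'.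
  destruct (HK x y x' y') as [A1 A2]. destruct (HL x y x' y') as [B1 B2].
  split.
  - apply Rle_trans with (1 := Rabs_triang _ _). lra.
  - replace (f x y + g x y - (f x' y' + g x' y'))
      with ((f x y - f x' y') + (g x y - g x' y')) by ring.
    apply Rle_trans with (1 := Rabs_triang _ _). lra.
Qed.

Lemma bounded_lipschitz_mult (f g : R -> R -> R) :
  bounded_lipschitz f -> bounded_lipschitz g ->
  bounded_lipschitz (fun x y => f x y * g x y).
Proof.
  intros [K HK] [L HL]. exists (K * L + K * L).
  pose proof (slope_constant_nonneg f K HK) as K0.
  pose proof (slope_constant_nonneg g L HL) as L0.
  assert (KL : 0 <= K * L) by now apply Rmult_le_pos.
  intros x y x' y'.
  destruct (HK x y x' y') as [A1 A2]. destruct (HL x y x' y') as [B1 B2].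
  destruct (HL x' y' x y) as [B1' _].
  split.
  - rewrite Rabs_mult.
    apply Rle_trans with (K * L); [ | lra].
    apply Rmult_le_compat; auto using Rabs_pos.
  - replace (f x y * g x y - f x' y' * g x' y')
      with (f x y * (g x y - g x' y') + (f x y - f x' y') * g x' y') by ring.
    apply Rle_trans with (1 := Rabs_triang _ _). rewrite !Rabs_mult.
    set (D := Rabs (x - x') + Rabs (y - y')) in *.
    apply Rle_trans with (K * (L * D) + K * D * L); [ | apply Req_le; ring].
    apply Rplus_le_compat; apply Rmult_le_compat; auto using Rabs_pos.
Qed.

(** The square root is Lipschitz away from 0:
    [sqrt a - sqrt b = (a - b) / (sqrt a + sqrt b)]. *)
Lemma bounded_lipschitz_sqrt (f : R -> R -> R) (c : R) :
  0 < c -> (forall x y, c <= f x y) -> bounded_lipschitz f ->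
  bounded_lipschitz (fun x y => sqrt (f x y)).
Proof.
  intros Hc Hfc [K HK]. pose proof (slope_constant_nonneg f K HK) as K0.
  pose proof (sqrt_lt_R0 c Hc) as Hsc.
  assert (Hs : forall x y, sqrt c <= sqrt (f x y)) by (intros; now apply sqrt_le_1_alt).
  exists (K / sqrt c). intros x y x' y'.
  pose proof (Hs x y) as S1. pose proof (Hs x' y') as S2.
  pose proof (Hfc x y) as F1. pose proof (Hfc x' y') as F2.
  destruct (HK x y x' y') as [A1 A2].
  set (D := Rabs (x - x') + Rabs (y - y')) in *.
  split.
  - rewrite Rabs_pos_eq by apply sqrt_pos. apply Rle_div_r; [exact Hsc | ].
    apply Rle_trans with (sqrt (f x y) * sqrt (f x y)).
    + apply Rmult_le_compat_l; [apply sqrt_pos | exact S1].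
    + rewrite sqrt_sqrt by lra. pose proof (Rle_abs (f x y)). lra.
  - replace (K / sqrt c * D) with (K * D / sqrt c) by (field; lra).
    apply Rle_div_r; [exact Hsc | ].
    apply Rle_trans with (2 := A2).
    replace (f x y - f x' y')
      with ((sqrt (f x y) - sqrt (f x' y')) * (sqrt (f x y) + sqrt (f x' y'))).
    2:{ transitivity (sqrt (f x y) * sqrt (f x y) - sqrt (f x' y') * sqrt (f x' y'));
        [ring | rewrite !sqrt_sqrt; lra]. }
    rewrite Rabs_mult. apply Rmult_le_compat_l; [apply Rabs_pos | ].
    rewrite Rabs_pos_eq; lra.
Qed.

Lemma bounded_lipschitz_inv (f : R -> R -> R) (c : R) :
  0 < c -> (forall x y, c <= Rabs (f x y)) -> bounded_lipschitz f ->
  bounded_lipschitz (fun x y => / f x y).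
Proof.
  intros Hc Hfc [K HK]. pose proof (slope_constant_nonneg f K HK) as K0.
  assert (Hc' : 0 < / c) by now apply Rinv_0_lt_compat.
  assert (Hi : forall x y, Rabs (/ f x y) <= / c).
  { intros x y. rewrite Rabs_inv. apply Rinv_le_contravar; auto. }
  assert (Hn : forall x y, f x y <> 0).
  { intros x y E. specialize (Hfc x y). rewrite E, Rabs_R0 in Hfc. lra. }
  assert (HKcc : 0 <= K * (/ c * / c)) by (apply Rmult_le_pos; nra).
  exists (/ c + K * (/ c * / c)). intros x y x' y'. split.
  - specialize (Hi x y). lra.
  - replace (/ f x y - / f x' y')
      with (- (f x y - f x' y') * (/ f x y * / f x' y')) by (field; auto).
    rewrite Rabs_mult, Rabs_Ropp, (Rabs_mult (/ f x y)).
    set (D := Rabs (x - x') + Rabs (y - y')).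
    assert (HD : 0 <= D).
    { unfold D. pose proof (Rabs_pos (x - x')). pose proof (Rabs_pos (y - y')). lra. }
    apply Rle_trans with (K * D * (/ c * / c)).
    + apply Rmult_le_compat; auto using Rabs_pos.
      * apply Rmult_le_pos; apply Rabs_pos.
      * apply (HK x y x' y').
      * apply Rmult_le_compat; auto using Rabs_pos.
    + assert (0 <= / c * D) by (apply Rmult_le_pos; lra). lra.
Qed.

Lemma bounded_lipschitz_flip (f : R -> R -> R) :
  bounded_lipschitz f -> bounded_lipschitz (fun x y => f y x).
Proof.
  intros [K HK]. exists K. intros x y x' y'.
  rewrite (Rplus_comm (Rabs (x - x'))). apply HK.
Qed.

Lemma bounded_lipschitz_continuous (f : R -> R -> R) (w : R * R) :
  bounded_lipschitz f -> continuous (fun w => f (fst w) (snd w)) w.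
Proof.
  intros [K HK]. destruct w as [x y].
  pose proof (slope_constant_nonneg f K HK) as K0.
  apply (proj1 (continuity_2d_pt_filterlim f x y)). intros eps.
  assert (E : 0 < eps / (2 * (K + 1))).
  { apply Rdiv_lt_0_compat; [apply cond_pos | lra]. }
  exists (mkposreal _ E). intros u v Hu Hv. simpl in Hu, Hv.
  apply Rle_lt_trans with (1 := proj2 (HK u v x y)).
  apply Rle_lt_trans with ((K + 1) * (Rabs (u - x) + Rabs (v - y))).
  - pose proof (Rabs_pos (u - x)). pose proof (Rabs_pos (v - y)).
    apply Rmult_le_compat_r; lra.
  - replace (pos eps) with ((K + 1) * (eps / (2 * (K + 1)) + eps / (2 * (K + 1))))
      by (field; lra).
    apply Rmult_lt_compat_l; lra.
Qed.

(** * Line fields solving a quadratic equation *)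

Definition lipschitz_near (f : R -> R -> R) (x0 y0 : R) : Prop :=
  exists e K, 0 < e /\ 0 <= K /\
    forall x y x' y',
      Rabs (x - x0) <= e -> Rabs (y - y0) <= e ->
      Rabs (x' - x0) <= e -> Rabs (y' - y0) <= e ->
      Rabs (f x y - f x' y') <= K * (Rabs (x - x') + Rabs (y - y')).

Definition clamp2 (x0 y0 e : R) (f : R -> R -> R) (x y : R) : R :=
  f (clamp x0 e x) (clamp y0 e y).

Lemma clamp2_bounded_lipschitz (f : R -> R -> R) (x0 y0 : R) :
  lipschitz_near f x0 y0 ->
  exists e, 0 < e /\ forall r, 0 < r -> r <= e ->
    bounded_lipschitz (clamp2 x0 y0 r f).
Proof.
  intros [e [K [He [HK H]]]]. exists e. split; [exact He | ].
  intros r Hr Hre. exists (Rabs (f x0 y0) + K * (2 * r) + K).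
  pose proof (Rabs_pos (f x0 y0)) as Hf0.
  assert (HKr : 0 <= K * (2 * r)) by (apply Rmult_le_pos; lra).
  assert (Hc : forall c x, Rabs (clamp c r x - c) <= r)
    by (intros; apply clamp_close; lra).
  intros x y x' y'. unfold clamp2.
  pose proof (Hc x0 x). pose proof (Hc y0 y).
  pose proof (Hc x0 x'). pose proof (Hc y0 y').
  split.
  - apply Rle_trans with (Rabs (f x0 y0) + K * (2 * r)); [ | lra].
    replace (f (clamp x0 r x) (clamp y0 r y))
      with (f x0 y0 + (f (clamp x0 r x) (clamp y0 r y) - f x0 y0)) by ring.
    apply Rle_trans with (1 := Rabs_triang _ _). apply Rplus_le_compat_l.
    apply Rle_trans with (K * (Rabs (clamp x0 r x - x0) + Rabs (clamp y0 r y - y0))).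
    + apply H; try lra; rewrite Rminus_diag, Rabs_R0; lra.
    + apply Rmult_le_compat_l; lra.
  - apply Rle_trans with (K * (Rabs (x - x') + Rabs (y - y'))).
    + apply Rle_trans with
        (K * (Rabs (clamp x0 r x - clamp x0 r x')
              + Rabs (clamp y0 r y - clamp y0 r y'))).
      * apply H; lra.
      * apply Rmult_le_compat_l; [exact HK | ].
        apply Rplus_le_compat; apply clamp_lipschitz.
    + apply Rmult_le_compat_r; [ | lra].
      pose proof (Rabs_pos (x - x')). pose proof (Rabs_pos (y - y')). lra.
Qed.

Lemma lipschitz_near_continuity (f : R -> R -> R) (x0 y0 : R) :
  lipschitz_near f x0 y0 -> continuity_2d_pt f x0 y0.
Proof.
  intros Hf. destruct (clamp2_bounded_lipschitz f x0 y0 Hf) as [e [He H]].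
  specialize (H e He (Rle_refl e)).
  apply continuity_2d_pt_ext_loc with (clamp2 x0 y0 e f).
  - exists (mkposreal e He). intros u v Hu Hv. simpl in Hu, Hv. unfold clamp2.
    rewrite !clamp_id; [reflexivity | lra | lra].
  - apply continuity_2d_pt_filterlim.
    exact (bounded_lipschitz_continuous _ (x0, y0) H).
Qed.

Lemma locally_2d_closed_square (P : R -> R -> Prop) (x0 y0 : R) :
  locally_2d P x0 y0 ->
  exists e, 0 < e /\
    forall x y, Rabs (x - x0) <= e -> Rabs (y - y0) <= e -> P x y.
Proof.
  intros [d H]. exists (d / 2). pose proof (cond_pos d).
  split; [lra | ]. intros x y Hx Hy. apply H; lra.
Qed.

Lemma open_square (u0 eps : R) : open (square u0 eps).
Proof.
  intros [x y] [Hx Hy]. simpl in Hx, Hy.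
  apply (proj1 (locally_2d_locally (fun u v => square u0 eps (u, v)) x y)).
  assert (Hd : 0 < Rmin (eps - Rabs (x - u0)) (eps - Rabs y))
    by (apply Rmin_glb_lt; lra).
  exists (mkposreal _ Hd). simpl. intros u v Hu Hv.
  pose proof (Rmin_l (eps - Rabs (x - u0)) (eps - Rabs y)).
  pose proof (Rmin_r (eps - Rabs (x - u0)) (eps - Rabs y)).
  split; simpl.
  - replace (u - u0) with ((u - x) + (x - u0)) by ring.
    apply Rle_lt_trans with (1 := Rabs_triang _ _). lra.
  - replace v with ((v - y) + y) by ring.
    apply Rle_lt_trans with (1 := Rabs_triang _ _). lra.
Qed.

Section QuadraticEquation.

Variables (l m p : R -> R -> R) (u0 : R).
Hypothesis Hl : lipschitz_near l u0 0.
Hypothesis Hm : lipschitz_near m u0 0.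
Hypothesis Hp : lipschitz_near p u0 0.

Definition discriminant (u v : R) : R := m u v * m u v + -4 * (l u v * p u v).

(** For [sigma = 1] or [-1], this is [-2 l t] where [t] is a root of
    [l t^2 + m t + p]; unlike [t] it makes sense when [l] vanishes. *)
Definition root (sigma u v : R) : R := m u v + sigma * sqrt (discriminant u v).

Hypothesis Hdisc : 0 < discriminant u0 0.

(** Giving the square root the sign of [m] prevents a cancellation. *)
Lemma sign_choice : exists sigma, sigma * sigma = 1 /\ root sigma u0 0 <> 0.
Proof.
  pose proof (sqrt_lt_R0 _ Hdisc) as Hs. unfold root.
  destruct (Rle_lt_dec 0 (m u0 0)) as [H | H]; [exists 1 | exists (-1)];
    split; lra.
Qed.

Variable sigma : R.
Hypothesis Hsigma : sigma * sigma = 1.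
Hypothesis Hroot : root sigma u0 0 <> 0.

Lemma discriminant_continuity : continuity_2d_pt discriminant u0 0.
Proof.
  unfold discriminant.
  apply continuity_2d_pt_plus; [ | apply continuity_2d_pt_mult;
    [apply continuity_2d_pt_const | ]];
    apply continuity_2d_pt_mult; now apply lipschitz_near_continuity.
Qed.

Lemma root_continuity : continuity_2d_pt (root sigma) u0 0.
Proof.
  unfold root. apply continuity_2d_pt_plus; [now apply lipschitz_near_continuity | ].
  apply continuity_2d_pt_mult; [apply continuity_2d_pt_const | ].
  apply continuity_1d_2d_pt_comp; [ | apply discriminant_continuity].
  apply continuity_pt_filterlim, continuous_sqrt.
Qed.

(** The integration theory needs slopes defined on the plane.  On a small closed
    square the discriminant and the chosen root stay away from 0, and clamping
    the coefficients to it gives functions with the same property everywhere. *)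
Lemma globalization (Q : R -> R -> Prop) :
  locally_2d Q u0 0 ->
  exists (eps : R) (L P V : R -> R -> R),
    0 < eps /\
    bounded_lipschitz L /\ bounded_lipschitz P /\ bounded_lipschitz V /\
    bounded_lipschitz (fun u v => / V u v) /\
    (forall u v, V u v <> 0) /\
    (forall u v, square u0 eps (u, v) ->
       L u v = l u v /\ P u v = p u v /\ V u v = root sigma u v /\
       0 < discriminant u v /\ Q u v).
Proof.
  intros HQ.
  pose (d0 := discriminant u0 0 / 2). pose (w0 := Rabs (root sigma u0 0) / 2).
  assert (Hd0 : 0 < d0) by (unfold d0; lra).
  assert (Hw0 : 0 < w0).
  { unfold w0. pose proof (Rabs_pos_lt _ Hroot). lra. }
  pose proof (discriminant_continuity (mkposreal _ Hd0)) as C1.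
  pose proof (root_continuity (mkposreal _ Hw0)) as C2.
  simpl in C1, C2.
  destruct (locally_2d_closed_square _ _ _
              (locally_2d_and _ _ _ _ C1 (locally_2d_and _ _ _ _ C2 HQ)))
    as [e0 [He0 H]].
  destruct (clamp2_bounded_lipschitz l u0 0 Hl) as [e1 [He1 B1]].
  destruct (clamp2_bounded_lipschitz m u0 0 Hm) as [e2 [He2 B2]].
  destruct (clamp2_bounded_lipschitz p u0 0 Hp) as [e3 [He3 B3]].
  pose (eps := Rmin e0 (Rmin e1 (Rmin e2 e3))).
  assert (Heps : 0 < eps) by (repeat apply Rmin_glb_lt; assumption).
  assert (E0 : eps <= e0) by apply Rmin_l.
  assert (E1 : eps <= Rmin e1 (Rmin e2 e3)) by apply Rmin_r.
  assert (E2 : Rmin e1 (Rmin e2 e3) <= e1) by apply Rmin_l.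
  assert (E3 : Rmin e1 (Rmin e2 e3) <= Rmin e2 e3) by apply Rmin_r.
  assert (E4 : Rmin e2 e3 <= e2) by apply Rmin_l.
  assert (E5 : Rmin e2 e3 <= e3) by apply Rmin_r.
  specialize (B1 eps Heps ltac:(lra)). specialize (B2 eps Heps ltac:(lra)).
  specialize (B3 eps Heps ltac:(lra)).
  assert (HC : forall u v, let u' := clamp u0 eps u in let v' := clamp 0 eps v in
            d0 <= discriminant u' v' /\ w0 <= Rabs (root sigma u' v')).
  { intros u v u' v'.
    pose proof (clamp_close u0 eps u (Rlt_le _ _ Heps)) as Hu.
    pose proof (clamp_close 0 eps v (Rlt_le _ _ Heps)) as Hv.
    fold u' in Hu. fold v' in Hv.
    destruct (H u' v' ltac:(lra) ltac:(lra)) as [H1 [H2 _]].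
    split.
    - apply Rabs_def2 in H1. unfold d0 in *. lra.
    - pose proof (Rabs_triang_inv (root sigma u0 0) (root sigma u' v')) as T.
      rewrite Rabs_minus_sym in T. unfold w0 in *. lra. }
  assert (BD : bounded_lipschitz (clamp2 u0 0 eps discriminant)).
  { apply bounded_lipschitz_plus; [now apply bounded_lipschitz_mult | ].
    apply bounded_lipschitz_mult; [apply bounded_lipschitz_const | ].
    now apply bounded_lipschitz_mult. }
  assert (BV : bounded_lipschitz (clamp2 u0 0 eps (root sigma))).
  { apply bounded_lipschitz_plus; [exact B2 | ].
    apply bounded_lipschitz_mult; [apply bounded_lipschitz_const | ].
    apply bounded_lipschitz_sqrt with d0; [exact Hd0 | | exact BD].
    intros u v. apply HC. }
  exists eps, (clamp2 u0 0 eps l), (clamp2 u0 0 eps p), (clamp2 u0 0 eps (root sigma)).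
  split; [exact Heps | ]. split; [exact B1 | ]. split; [exact B3 | ].
  split; [exact BV | ]. split; [ | split].
  - apply bounded_lipschitz_inv with w0; [exact Hw0 | | exact BV].
    intros u v. apply HC.
  - intros u v E. unfold clamp2 in E. destruct (HC u v) as [_ Hw].
    simpl in Hw. rewrite E, Rabs_R0 in Hw. lra.
  - intros u v [Hu Hv]. simpl in Hu, Hv.
    assert (Hv' : Rabs (v - 0) <= eps) by (rewrite Rminus_0_r; lra).
    destruct (H u v ltac:(lra) ltac:(lra)) as [H1 [_ HQuv]].
    unfold clamp2. rewrite !clamp_id by lra.
    repeat split; try assumption.
    apply Rabs_def2 in H1. unfold d0 in *. lra.
Qed.

Lemma root_equation (u v : R) :
  0 <= discriminant u v ->
  root sigma u v * root sigma u v = 2 * m u v * root sigma u v - 4 * (l u v * p u v).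
Proof.
  intros H. unfold root. pose proof (sqrt_sqrt _ H) as Hs.
  set (s := sqrt (discriminant u v)) in *. unfold discriminant in Hs.
  replace ((m u v + sigma * s) * (m u v + sigma * s))
    with (m u v * m u v + 2 * m u v * (sigma * s) + (sigma * sigma) * (s * s)) by ring.
  rewrite Hsigma, Hs. ring.
Qed.

(** The identity behind the factorization is
    [(a w + 2 b l) (-2 a p - b w) = -2 w (l b^2 + m a b + p a^2)], which follows
    from [w^2 = 2 m w - 4 l p].  The two directions [(-2 l, w)] and [(w, -2 p)]
    are distinct because [w^2 - 4 l p = 2 w (w - m)] and
    [(w - m)^2] is the discriminant. *)
Lemma quadratic_line_fields (Q : R -> R -> Prop) :
  locally_2d Q u0 0 ->
  exists (eps : R) (X Y : R * R -> R * R) (f : R -> R -> R),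
    0 < eps /\
    (forall u v, square u0 eps (u, v) -> Q u v) /\
    foliation (square u0 eps) X /\ foliation (square u0 eps) Y /\
    (forall w, square u0 eps w -> ~ parallel (X w) (Y w)) /\
    (forall u v, square u0 eps (u, v) -> forall a b : R,
       l u v * b ^ 2 + m u v * a * b + p u v * a ^ 2 = 0 <->
       (parallel (a, b) (X (u, v)) \/ parallel (a, b) (Y (u, v)))) /\
    (forall w, snd (X w) <> 0) /\
    (forall u v, square u0 eps (u, v) -> snd (Y (u, v)) = -2 * p u v) /\
    has_slope (square u0 eps) Y f /\ bounded_lipschitz f /\
    (forall u v, square u0 eps (u, v) -> f u v = p u v * (-2 * / root sigma u v)).
Proof.
  intros HQ.
  destruct (globalization Q HQ)
    as [eps [L [P [V [Heps [BL [BP [BV [BI [HV H]]]]]]]]]].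
  pose (X := fun w : R * R => (-2 * L (fst w) (snd w), V (fst w) (snd w))).
  pose (Y := fun w : R * R => (V (fst w) (snd w), -2 * P (fst w) (snd w))).
  assert (BL2 : bounded_lipschitz (fun u v => -2 * L u v)).
  { apply bounded_lipschitz_mult; [apply bounded_lipschitz_const | exact BL]. }
  assert (BP2 : bounded_lipschitz (fun u v => -2 * P u v)).
  { apply bounded_lipschitz_mult; [apply bounded_lipschitz_const | exact BP]. }
  assert (CX : forall w, continuous X w).
  { intros w. apply continuous_pair_intro.
    - exact (bounded_lipschitz_continuous _ w BL2).
    - exact (bounded_lipschitz_continuous _ w BV). }
  assert (CY : forall w, continuous Y w).
  { intros w. apply continuous_pair_intro.
    - exact (bounded_lipschitz_continuous _ w BV).
    - exact (bounded_lipschitz_continuous _ w BP2). }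
  assert (SY : has_slope (square u0 eps) Y (fun u v => -2 * P u v * / V u v)).
  { intros w _. simpl. split; [apply HV | field; apply HV]. }
  assert (BY : bounded_lipschitz (fun u v => -2 * P u v * / V u v)).
  { now apply bounded_lipschitz_mult. }
  assert (Hvieta : forall u v, square u0 eps (u, v) ->
    V u v * V u v = 2 * m u v * V u v - 4 * (L u v * P u v) /\ V u v <> m u v).
  { intros u v Huv. destruct (H u v Huv) as [-> [-> [-> [HD _]]]].
    split; [apply root_equation; lra | ].
    unfold root. intros E. pose proof (sqrt_lt_R0 _ HD) as Hs.
    assert (E0 : sigma * sqrt (discriminant u v) = 0) by lra.
    apply Rmult_integral in E0. destruct E0 as [E0 | E0]; [ | lra].
    rewrite E0 in Hsigma. lra. }
  exists eps, X, Y, (fun u v => -2 * P u v * / V u v).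
  split; [exact Heps | ]. split; [intros u v Huv; now apply H | ].
  split; [ | split; [ | split; [ | split; [ | split; [ | split; [ | split; [ | split]]]]]]].
  - apply foliation_swap.
    apply foliation_of_slope with (fun v u => -2 * L u v * / V u v).
    + intros w _. simpl. split; [apply HV | field; apply HV].
    + apply (bounded_lipschitz_flip (fun u v => -2 * L u v * / V u v)).
      now apply bounded_lipschitz_mult.
    + apply (open_comp swap); [ | apply open_square].
      intros w _. apply continuous_swap.
    + intros w _.
      apply (continuous_comp (fun w => X (swap w)) swap); [ | apply continuous_swap].
      apply (continuous_comp swap X); [apply continuous_swap | apply CX].
  - apply foliation_of_slope with (fun u v => -2 * P u v * / V u v);
      [exact SY | exact BY | apply open_square | auto].
  - intros [u v] Huv Hpar. unfold parallel in Hpar; simpl in Hpar.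
    destruct (Hvieta u v Huv) as [E1 E2].
    assert (E3 : V u v * (m u v - V u v) = 0) by lra.
    apply Rmult_integral in E3. destruct E3 as [E3 | E3].
    + now apply (HV u v).
    + apply E2. lra.
  - intros u v Huv a b. destruct (Hvieta u v Huv) as [E1 _].
    destruct (H u v Huv) as [EL [EP _]].
    rewrite <- EL, <- EP. unfold parallel; simpl.
    assert (E : (a * V u v - b * (-2 * L u v)) * (a * (-2 * P u v) - b * V u v)
                = -2 * V u v * (L u v * b ^ 2 + m u v * a * b + P u v * a ^ 2)).
    { replace ((a * V u v - b * (-2 * L u v)) * (a * (-2 * P u v) - b * V u v))
        with (-2 * P u v * a ^ 2 * V u v - a * b * (V u v * V u v)
              - 4 * (L u v * P u v) * a * b - 2 * L u v * b ^ 2 * V u v) by ring.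
      rewrite E1. ring. }
    split.
    + intros E0. apply Rmult_integral.
      transitivity (-2 * V u v * (L u v * b ^ 2 + m u v * a * b + P u v * a ^ 2));
        [exact E | ].
      unfold Rsqr in *; simpl pow in *. rewrite E0. ring.
    + intros Hor.
      assert (E0 : -2 * V u v * (L u v * b ^ 2 + m u v * a * b + P u v * a ^ 2) = 0).
      { rewrite <- E. destruct Hor as [-> | ->]; ring. }
      apply Rmult_integral in E0. destruct E0 as [E0 | E0]; [ | exact E0].
      exfalso. apply (HV u v). lra.
  - intros w. apply HV.
  - intros u v Huv. simpl. destruct (H u v Huv) as [_ [-> _]]. reflexivity.
  - exact SY.
  - exact BY.
  - intros u v Huv. destruct (H u v Huv) as [_ [-> [-> _]]]. ring.
Qed.

End QuadraticEquation.

Lemma transversal_of_snd_neq_0 (U : R * R -> Prop) (X : R * R -> R * R) :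
  (forall u, U (u, 0) -> snd (X (u, 0)) <> 0) -> transversal_to_axis U X.
Proof.
  intros HX g t Hg Ht H0 Hpar.
  destruct (Hg t Ht) as [HU [_ [_ [_ [Hv Hp]]]]].
  rewrite (surjective_pairing (Defs.pos g t)), H0 in HU, Hp.
  unfold parallel in *. cbn [fst snd] in Hpar.
  assert (E : snd (velocity g t) = 0) by lra.
  rewrite E in Hp.
  assert (E' : fst (velocity g t) * snd (X (fst (Defs.pos g t), 0)) = 0) by lra.
  apply Rmult_integral in E'. destruct E' as [E' | E'].
  - apply Hv. rewrite (surjective_pairing (velocity g t)), E, E'. reflexivity.
  - exact (HX _ HU E').
Qed.

(** * Smooth functions of two variables and their division by v *)

Definition D1 (f : R -> R -> R) (u v : R) : R := Derive (fun s => f s v) u.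
Definition D2 (f : R -> R -> R) (u v : R) : R := Derive (fun s => f u s) v.

(** Smoothness is recovered by quantifying over [n].  The order is kept explicit
    because the induction for a product uses, at order [n], both factors and
    their derivatives. *)
Definition differentiable_upto (n : nat) (W : R * R -> Prop) (f : R -> R -> R) : Prop :=
  forall u v, W (u, v) -> ex_diff_n f n u v.

Section SmoothFunctions.

Variable W : R * R -> Prop.
Hypothesis HW : open W.

Lemma open_locally_2d (u v : R) : W (u, v) -> locally_2d (fun u v => W (u, v)) u v.
Proof.
  intros H. apply locally_2d_locally.
  generalize (HW _ H). apply filter_imp. now intros [x y].
Qed.

Lemma differentiable_upto_S (n : nat) (f g1 g2 : R -> R -> R) :
  (forall u v, W (u, v) -> continuity_2d_pt f u v) ->
  (forall u v, W (u, v) -> is_derive (fun s => f s v) u (g1 u v)) ->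
  (forall u v, W (u, v) -> is_derive (fun s => f u s) v (g2 u v)) ->
  differentiable_upto n W g1 -> differentiable_upto n W g2 ->
  differentiable_upto (S n) W f.
Proof.
  intros Hc H1 H2 Hg1 Hg2 u v H.
  split; [now apply Hc | ].
  split; [eexists; now apply H1 | ]. split; [eexists; now apply H2 | ].
  split; [apply ex_diff_n_ext_loc with g1 | apply ex_diff_n_ext_loc with g2];
    auto; generalize (open_locally_2d u v H); apply locally_2d_impl, locally_2d_forall;
    intros x y Hxy; symmetry; apply is_derive_unique; auto.
Qed.

Lemma differentiable_upto_continuity (n : nat) (f : R -> R -> R) (u v : R) :
  differentiable_upto n W f -> W (u, v) -> continuity_2d_pt f u v.
Proof. intros Hf H. specialize (Hf u v H). destruct n; apply Hf. Qed.

Lemma differentiable_upto_derive1 (n : nat) (f : R -> R -> R) (u v : R) :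
  differentiable_upto (S n) W f -> W (u, v) -> is_derive (fun s => f s v) u (D1 f u v).
Proof. intros Hf H. apply Derive_correct. apply (Hf u v H). Qed.

Lemma differentiable_upto_derive2 (n : nat) (f : R -> R -> R) (u v : R) :
  differentiable_upto (S n) W f -> W (u, v) -> is_derive (fun s => f u s) v (D2 f u v).
Proof. intros Hf H. apply Derive_correct. apply (Hf u v H). Qed.

Lemma differentiable_upto_D1 (n : nat) (f : R -> R -> R) :
  differentiable_upto (S n) W f -> differentiable_upto n W (D1 f).
Proof. intros Hf u v H. apply (Hf u v H). Qed.

Lemma differentiable_upto_D2 (n : nat) (f : R -> R -> R) :
  differentiable_upto (S n) W f -> differentiable_upto n W (D2 f).
Proof. intros Hf u v H. apply (Hf u v H). Qed.

Lemma differentiable_upto_pred (n : nat) (f : R -> R -> R) :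
  differentiable_upto (S n) W f -> differentiable_upto n W f.
Proof. intros Hf u v H. apply ex_diff_n_m with (S n); [lia | auto]. Qed.

Lemma differentiable_upto_plus (n : nat) (f g : R -> R -> R) :
  differentiable_upto n W f -> differentiable_upto n W g ->
  differentiable_upto n W (fun u v => f u v + g u v).
Proof.
  revert f g. induction n as [ | n IH]; intros f g Hf Hg.
  - intros u v H. split; [ | exact I].
    apply continuity_2d_pt_plus; now apply (differentiable_upto_continuity 0).
  - apply (differentiable_upto_S n _ (fun u v => D1 f u v + D1 g u v)
             (fun u v => D2 f u v + D2 g u v)).
    + intros u v H.
      apply continuity_2d_pt_plus; now apply (differentiable_upto_continuity (S n)).
    + intros u v H.
      apply @is_derive_plus; now apply (differentiable_upto_derive1 n).
    + intros u v H.
      apply @is_derive_plus; now apply (differentiable_upto_derive2 n).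
    + apply IH; now apply differentiable_upto_D1.
    + apply IH; now apply differentiable_upto_D2.
Qed.

Lemma differentiable_upto_mult (n : nat) (f g : R -> R -> R) :
  differentiable_upto n W f -> differentiable_upto n W g ->
  differentiable_upto n W (fun u v => f u v * g u v).
Proof.
  revert f g. induction n as [ | n IH]; intros f g Hf Hg.
  - intros u v H. split; [ | exact I].
    apply continuity_2d_pt_mult; now apply (differentiable_upto_continuity 0).
  - apply (differentiable_upto_S n _ (fun u v => D1 f u v * g u v + f u v * D1 g u v)
             (fun u v => D2 f u v * g u v + f u v * D2 g u v)).
    + intros u v H.
      apply continuity_2d_pt_mult; now apply (differentiable_upto_continuity (S n)).
    + intros u v H. apply (is_derive_mult (fun s => f s v) (fun s => g s v));
        try (now apply (differentiable_upto_derive1 n)).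
      intros; apply Rmult_comm.
    + intros u v H. apply (is_derive_mult (fun s => f u s) (fun s => g u s));
        try (now apply (differentiable_upto_derive2 n)).
      intros; apply Rmult_comm.
    + apply differentiable_upto_plus; apply IH;
        solve [now apply differentiable_upto_D1 | now apply differentiable_upto_pred].
    + apply differentiable_upto_plus; apply IH;
        solve [now apply differentiable_upto_D2 | now apply differentiable_upto_pred].
Qed.

Lemma differentiable_upto_const (n : nat) (c : R) :
  differentiable_upto n W (fun _ _ => c).
Proof.
  revert c. induction n as [ | n IH]; intros c.
  - intros u v _. split; [apply continuity_2d_pt_const | exact I].
  - apply (differentiable_upto_S n _ (fun _ _ => 0) (fun _ _ => 0)); auto;
      intros u v _; [apply continuity_2d_pt_const | | ];
      apply (is_derive_const (V := R_NormedModule)).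
Qed.

Lemma smooth2_plus (f g : R -> R -> R) :
  smooth2 W f -> smooth2 W g -> smooth2 W (fun u v => f u v + g u v).
Proof.
  intros Hf Hg n. apply differentiable_upto_plus; [exact (Hf n) | exact (Hg n)].
Qed.

Lemma smooth2_mult (f g : R -> R -> R) :
  smooth2 W f -> smooth2 W g -> smooth2 W (fun u v => f u v * g u v).
Proof.
  intros Hf Hg n. apply differentiable_upto_mult; [exact (Hf n) | exact (Hg n)].
Qed.

Lemma smooth2_minus (f g : R -> R -> R) :
  smooth2 W f -> smooth2 W g -> smooth2 W (fun u v => f u v - g u v).
Proof.
  intros Hf Hg n u v H.
  apply ex_diff_n_ext_loc with (fun u v => f u v + -1 * g u v).
  - apply locally_2d_forall. intros x y. ring.
  - revert u v H. apply differentiable_upto_plus; [exact (Hf n) | ].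
    apply differentiable_upto_mult; [apply differentiable_upto_const | exact (Hg n)].
Qed.

Lemma smooth2_D1 (f : R -> R -> R) : smooth2 W f -> smooth2 W (D1 f).
Proof. intros Hf n. exact (differentiable_upto_D1 n f (Hf (S n))). Qed.

Lemma smooth2_D2 (f : R -> R -> R) : smooth2 W f -> smooth2 W (D2 f).
Proof. intros Hf n. exact (differentiable_upto_D2 n f (Hf (S n))). Qed.

Lemma smooth2_continuity (f : R -> R -> R) (u v : R) :
  smooth2 W f -> W (u, v) -> continuity_2d_pt f u v.
Proof. intros Hf. exact (differentiable_upto_continuity 0 f u v (Hf 0%nat)). Qed.

Lemma smooth2_derive1 (f : R -> R -> R) (u v : R) :
  smooth2 W f -> W (u, v) -> is_derive (fun s => f s v) u (D1 f u v).
Proof. intros Hf. exact (differentiable_upto_derive1 0 f u v (Hf 1%nat)). Qed.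

Lemma smooth2_derive2 (f : R -> R -> R) (u v : R) :
  smooth2 W f -> W (u, v) -> is_derive (fun s => f u s) v (D2 f u v).
Proof. intros Hf. exact (differentiable_upto_derive2 0 f u v (Hf 1%nat)). Qed.

Lemma smooth2_Schwarz (f : R -> R -> R) (u v : R) :
  smooth2 W f -> W (u, v) -> D1 (D2 f) u v = D2 (D1 f) u v.
Proof.
  intros Hf H. apply (Schwarz f).
  - generalize (open_locally_2d u v H). apply locally_2d_impl, locally_2d_forall.
    intros x y Hxy. split; [ | split; [ | split]].
    + eexists. now apply smooth2_derive1.
    + eexists. now apply smooth2_derive2.
    + eexists. apply (smooth2_derive1 (D2 f)); [now apply smooth2_D2 | exact Hxy].
    + eexists. apply (smooth2_derive2 (D1 f)); [now apply smooth2_D1 | exact Hxy].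
  - apply (smooth2_continuity (D1 (D2 f))); [ | exact H].
    now apply smooth2_D1, smooth2_D2.
  - apply (smooth2_continuity (D2 (D1 f))); [ | exact H].
    now apply smooth2_D2, smooth2_D1.
Qed.

(** Unlike in [derive_bound], the two points are arbitrary in a ball, whose
    convexity contains the intermediate point of the mean value theorem. *)
Lemma derive_bound_between (f df : R -> R) (a b c e C : R) :
  Rabs (a - c) <= e -> Rabs (b - c) <= e ->
  (forall t, Rabs (t - c) <= e -> is_derive f t (df t) /\ Rabs (df t) <= C) ->
  Rabs (f b - f a) <= C * Rabs (b - a).
Proof.
  intros Ha Hb H.
  assert (Hin : forall t, Rmin a b <= t <= Rmax a b -> Rabs (t - c) <= e).
  { intros t [H1 H2]. apply Rabs_le_between in Ha, Hb. apply Rabs_le.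
    unfold Rmin, Rmax in *. destruct (Rle_dec a b); lra. }
  destruct (MVT_gen f a b df) as [t [Ht ->]].
  - intros t Ht. apply H, Hin. lra.
  - intros t Ht. apply continuity_pt_filterlim.
    apply (ex_derive_continuous f). eexists. now apply H, Hin.
  - rewrite Rabs_mult. apply Rmult_le_compat_r; [apply Rabs_pos | now apply H, Hin].
Qed.

(** The partial derivatives are continuous, hence bounded near the point, and
    the increment is split along the two coordinate directions. *)
Lemma smooth2_lipschitz_near (f : R -> R -> R) (x0 y0 : R) :
  smooth2 W f -> W (x0, y0) -> lipschitz_near f x0 y0.
Proof.
  intros Hf H0.
  pose proof (smooth2_continuity _ x0 y0 (smooth2_D1 f Hf) H0 (mkposreal 1 Rlt_0_1)) as C1.
  pose proof (smooth2_continuity _ x0 y0 (smooth2_D2 f Hf) H0 (mkposreal 1 Rlt_0_1)) as C2.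
  simpl in C1, C2.
  destruct (locally_2d_closed_square _ _ _ (locally_2d_and _ _ _ _ (open_locally_2d _ _ H0)
              (locally_2d_and _ _ _ _ C1 C2))) as [e [He H]].
  set (A1 := Rabs (D1 f x0 y0) + 1). set (A2 := Rabs (D2 f x0 y0) + 1).
  pose proof (Rabs_pos (D1 f x0 y0)) as P1. pose proof (Rabs_pos (D2 f x0 y0)) as P2.
  exists e, (A1 + A2). split; [exact He | ]. split; [unfold A1, A2; lra | ].
  assert (HA : forall x y, Rabs (x - x0) <= e -> Rabs (y - y0) <= e ->
            W (x, y) /\ Rabs (D1 f x y) <= A1 /\ Rabs (D2 f x y) <= A2).
  { intros x y Hx Hy. destruct (H x y Hx Hy) as [HWxy [B1 B2]].
    pose proof (Rabs_triang_inv (D1 f x y) (D1 f x0 y0)).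
    pose proof (Rabs_triang_inv (D2 f x y) (D2 f x0 y0)).
    unfold A1, A2. repeat split; [exact HWxy | lra | lra]. }
  intros x y x' y' Hx Hy Hx' Hy'.
  assert (E1 : Rabs (f x y - f x' y) <= A1 * Rabs (x - x')).
  { apply (derive_bound_between (fun s => f s y) (fun s => D1 f s y) x' x x0 e A1 Hx' Hx).
    intros t Ht. destruct (HA t y Ht Hy) as [HWt [B _]].
    split; [now apply smooth2_derive1 | exact B]. }
  assert (E2 : Rabs (f x' y - f x' y') <= A2 * Rabs (y - y')).
  { apply (derive_bound_between (fun s => f x' s) (fun s => D2 f x' s) y' y y0 e A2 Hy' Hy).
    intros t Ht. destruct (HA x' t Hx' Ht) as [HWt [_ B]].
    split; [now apply smooth2_derive2 | exact B]. }
  replace (f x y - f x' y') with ((f x y - f x' y) + (f x' y - f x' y')) by ring.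
  apply Rle_trans with (1 := Rabs_triang _ _).
  pose proof (Rabs_pos (x - x')) as Q1. pose proof (Rabs_pos (y - y')) as Q2.
  assert (HA1 : 0 <= A1) by (unfold A1; lra). assert (HA2 : 0 <= A2) by (unfold A2; lra).
  pose proof (Rmult_le_pos _ _ HA1 Q2). pose proof (Rmult_le_pos _ _ HA2 Q1). lra.
Qed.

(** A path from 0 to [div_v phi u v], for [t] from 0 to 1, whose derivative
    [D2 phi u (t v)] has the same expression on and off the axis: this is the
    integrand of Hadamard's formula [phi u v / v = int_0^1 (D2 phi) u (t v) dt]. *)
Definition div_v_path (phi : R -> R -> R) (u v t : R) : R :=
  if Req_EM_T v 0 then t * D2 phi u 0 else phi u (t * v) / v.

Lemma div_v_path_derive (phi : R -> R -> R) (u v t : R) :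
  smooth2 W phi -> W (u, t * v) ->
  is_derive (div_v_path phi u v) t (D2 phi u (t * v)).
Proof.
  intros Hphi H. unfold div_v_path. destruct (Req_EM_T v 0) as [-> | Hv].
  - rewrite Rmult_0_r. auto_derive; [trivial | ring].
  - apply is_derive_ext with (fun t => / v * phi u (t * v)).
    { intros s. unfold Rdiv. apply Rmult_comm. }
    replace (D2 phi u (t * v)) with (/ v * (v * D2 phi u (t * v))) by (field; exact Hv).
    apply is_derive_scal.
    apply (is_derive_comp (fun s => phi u s) (fun t => t * v)).
    + now apply smooth2_derive2.
    + auto_derive; [trivial | ring].
Qed.

(** The mean value theorem for the difference of two paths bounds the increment
    of [div_v phi] by one of [D2 phi], which is Lipschitz. *)
Lemma div_v_lipschitz_near (phi : R -> R -> R) (u0 : R) :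
  smooth2 W phi -> W (u0, 0) -> (forall u, W (u, 0) -> phi u 0 = 0) ->
  lipschitz_near (div_v phi) u0 0.
Proof.
  intros Hphi H0 Hzero.
  destruct (smooth2_lipschitz_near (D2 phi) u0 0 (smooth2_D2 phi Hphi) H0)
    as [e1 [K [He1 [HK HL]]]].
  destruct (locally_2d_closed_square _ _ _ (open_locally_2d _ _ H0)) as [e2 [He2 HWe]].
  exists (Rmin e1 e2), K. split; [now apply Rmin_glb_lt | ]. split; [exact HK | ].
  pose proof (Rmin_l e1 e2). pose proof (Rmin_r e1 e2).
  intros u v u' v' Hu Hv Hu' Hv'. rewrite Rminus_0_r in Hv, Hv'.
  assert (Hshrink : forall t s, 0 <= t <= 1 -> Rabs s <= Rmin e1 e2 ->
            Rabs (t * s - 0) <= Rmin e1 e2).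
  { intros t s Ht Hs. rewrite Rminus_0_r, Rabs_mult, (Rabs_pos_eq t) by lra.
    pose proof (Rabs_pos s).
    assert (t * Rabs s <= 1 * Rabs s) by (apply Rmult_le_compat_r; lra). lra. }
  assert (Hends : forall u v, Rabs (u - u0) <= Rmin e1 e2 ->
            div_v phi u v = div_v_path phi u v 1 - div_v_path phi u v 0).
  { intros x y Hx. unfold div_v, div_v_path, D2. destruct (Req_EM_T y 0) as [E | E].
    - ring.
    - rewrite Rmult_1_l, Rmult_0_l, (Hzero x); [field; exact E | ].
      apply HWe; [lra | ]. rewrite Rminus_diag, Rabs_R0. lra. }
  rewrite (Hends u v Hu), (Hends u' v' Hu').
  replace (div_v_path phi u v 1 - div_v_path phi u v 0
           - (div_v_path phi u' v' 1 - div_v_path phi u' v' 0))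
    with ((div_v_path phi u v 1 - div_v_path phi u' v' 1)
          - (div_v_path phi u v 0 - div_v_path phi u' v' 0)) by ring.
  assert (Hd : forall t, 0 <= t <= 1 ->
            is_derive (fun t => div_v_path phi u v t - div_v_path phi u' v' t) t
              (D2 phi u (t * v) - D2 phi u' (t * v'))).
  { intros t Ht.
    pose proof (Hshrink t v Ht Hv). pose proof (Hshrink t v' Ht Hv').
    apply @is_derive_minus; apply div_v_path_derive; auto; apply HWe; lra. }
  destruct (MVT_gen (fun t => div_v_path phi u v t - div_v_path phi u' v' t) 0 1
              (fun t => D2 phi u (t * v) - D2 phi u' (t * v'))) as [t [Ht ->]].
  - intros t Ht. rewrite Rmin_left, Rmax_right in Ht by lra. apply Hd. lra.
  - intros t Ht. rewrite Rmin_left, Rmax_right in Ht by lra.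
    apply continuity_pt_filterlim.
    apply (ex_derive_continuous
             (fun t => div_v_path phi u v t - div_v_path phi u' v' t)).
    eexists. now apply Hd.
  - rewrite Rmin_left, Rmax_right in Ht by lra.
    pose proof (Hshrink t v Ht Hv). pose proof (Hshrink t v' Ht Hv').
    rewrite Rminus_0_r, Rmult_1_r.
    apply Rle_trans with (1 := HL u (t * v) u' (t * v') ltac:(lra) ltac:(lra)
                                 ltac:(lra) ltac:(lra)).
    apply Rmult_le_compat_l; [exact HK | ]. apply Rplus_le_compat_l.
    rewrite <- Rmult_minus_distr_l, Rabs_mult, (Rabs_pos_eq t) by lra.
    pose proof (Rabs_pos (v - v')).
    assert (t * Rabs (v - v') <= 1 * Rabs (v - v'))
      by (apply Rmult_le_compat_r; lra).
    lra.
Qed.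

End SmoothFunctions.

(** * Vectors and smooth maps *)

Lemma R3_eq (p q : R3) :
  coord1 p = coord1 q -> coord2 p = coord2 q -> coord3 p = coord3 q -> p = q.
Proof.
  destruct p as [[p1 p2] p3], q as [[q1 q2] q3].
  unfold coord1, coord2, coord3; simpl. now intros -> -> ->.
Qed.

Lemma dot_comm (p q : R3) : dot p q = dot q p.
Proof. unfold dot. ring. Qed.

(** The orthonormal frame [T, n, cross n T] spans the space.  For the difference
    [d] of the two vectors, the Gram identity below writes [d . d] in terms of
    its three vanishing products with the frame. *)
Lemma frame_determines (T n p q : R3) :
  dot T T = 1 -> dot n n = 1 -> dot n T = 0 ->
  dot p T = dot q T -> dot p n = dot q n ->
  dot p (cross n T) = dot q (cross n T) -> p = q.
Proof.
  intros HT Hn HnT H1 H2 H3.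
  pose (d := (coord1 p - coord1 q, coord2 p - coord2 q, coord3 p - coord3 q) : R3).
  assert (Hd : forall z, dot d z = dot p z - dot q z)
    by (intros z; unfold d, dot, coord1, coord2, coord3; simpl; ring).
  assert (Hd1 : dot d T = 0) by (rewrite Hd; lra).
  assert (Hd2 : dot d n = 0) by (rewrite Hd; lra).
  assert (Hd3 : dot d (cross n T) = 0) by (rewrite Hd; lra).
  assert (Hexp : dot d d * (dot n n * dot T T - dot n T * dot n T)
                 = dot d (cross n T) * dot d (cross n T)
                   + dot d n * (dot d n * dot T T - dot d T * dot n T)
                   + dot d T * (dot d T * dot n n - dot d n * dot n T)).
  { unfold dot, cross, coord1, coord2, coord3; simpl. ring. }
  rewrite Hd1, Hd2, Hd3, HT, Hn, HnT in Hexp.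
  assert (H0 : dot d d = 0) by lra.
  clear - H0. unfold d, dot, coord1, coord2, coord3 in H0; simpl in H0.
  apply R3_eq; unfold coord1, coord2, coord3; apply Rminus_diag_uniq, Rsqr_0_uniq;
    pose proof (Rle_0_sqr (fst (fst p) - fst (fst q)));
    pose proof (Rle_0_sqr (snd (fst p) - snd (fst q)));
    pose proof (Rle_0_sqr (snd p - snd q)); unfold Rsqr in *; lra.
Qed.

Section SmoothMaps.

Variable W : R * R -> Prop.
Hypothesis HW : open W.

Lemma smooth_map_du (x : R -> R -> R3) : smooth_map W x -> smooth_map W (du x).
Proof. intros [H1 [H2 H3]]. repeat split; now apply smooth2_D1. Qed.

Lemma smooth_map_dv (x : R -> R -> R3) : smooth_map W x -> smooth_map W (dv x).
Proof. intros [H1 [H2 H3]]. repeat split; now apply smooth2_D2. Qed.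

Lemma smooth2_dot (x y : R -> R -> R3) :
  smooth_map W x -> smooth_map W y -> smooth2 W (fun u v => dot (x u v) (y u v)).
Proof.
  intros [X1 [X2 X3]] [Y1 [Y2 Y3]]. unfold dot.
  apply smooth2_plus; [exact HW | apply smooth2_plus; [exact HW | | ] | ];
    now apply smooth2_mult.
Qed.

Lemma dot_derive1 (x y : R -> R -> R3) (u v : R) :
  smooth_map W x -> smooth_map W y -> W (u, v) ->
  is_derive (fun s : R => dot (x s v) (y s v)) u
    (dot (du x u v) (y u v) + dot (x u v) (du y u v)).
Proof.
  intros [X1 [X2 X3]] [Y1 [Y2 Y3]] H. unfold dot.
  pose proof (smooth2_derive1 W _ u v X1 H) as A1.
  pose proof (smooth2_derive1 W _ u v X2 H) as A2.
  pose proof (smooth2_derive1 W _ u v X3 H) as A3.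
  pose proof (smooth2_derive1 W _ u v Y1 H) as B1.
  pose proof (smooth2_derive1 W _ u v Y2 H) as B2.
  pose proof (smooth2_derive1 W _ u v Y3 H) as B3.
  pose proof (is_derive_mult _ _ _ _ _ A1 B1 Rmult_comm) as C1.
  pose proof (is_derive_mult _ _ _ _ _ A2 B2 Rmult_comm) as C2.
  pose proof (is_derive_mult _ _ _ _ _ A3 B3 Rmult_comm) as C3.
  evar_last.
  - apply @is_derive_plus; [apply @is_derive_plus; [exact C1 | exact C2] | exact C3].
  - unfold plus, mult; simpl.
    unfold du, dv, Derive3, D1, D2, coord1, coord2, coord3; simpl. ring.
Qed.

Lemma dot_derive2 (x y : R -> R -> R3) (u v : R) :
  smooth_map W x -> smooth_map W y -> W (u, v) ->
  is_derive (fun s : R => dot (x u s) (y u s)) v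
    (dot (dv x u v) (y u v) + dot (x u v) (dv y u v)).
Proof.
  intros [X1 [X2 X3]] [Y1 [Y2 Y3]] H. unfold dot.
  pose proof (smooth2_derive2 W _ u v X1 H) as A1.
  pose proof (smooth2_derive2 W _ u v X2 H) as A2.
  pose proof (smooth2_derive2 W _ u v X3 H) as A3.
  pose proof (smooth2_derive2 W _ u v Y1 H) as B1.
  pose proof (smooth2_derive2 W _ u v Y2 H) as B2.
  pose proof (smooth2_derive2 W _ u v Y3 H) as B3.
  pose proof (is_derive_mult _ _ _ _ _ A1 B1 Rmult_comm) as C1.
  pose proof (is_derive_mult _ _ _ _ _ A2 B2 Rmult_comm) as C2.
  pose proof (is_derive_mult _ _ _ _ _ A3 B3 Rmult_comm) as C3.
  evar_last.
  - apply @is_derive_plus; [apply @is_derive_plus; [exact C1 | exact C2] | exact C3].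
  - unfold plus, mult; simpl.
    unfold du, dv, Derive3, D1, D2, coord1, coord2, coord3; simpl. ring.
Qed.

Lemma du_dv_comm (x : R -> R -> R3) (u v : R) :
  smooth_map W x -> W (u, v) -> du (dv x) u v = dv (du x) u v.
Proof.
  intros [X1 [X2 X3]] H. apply R3_eq.
  - exact (smooth2_Schwarz W HW _ u v X1 H).
  - exact (smooth2_Schwarz W HW _ u v X2 H).
  - exact (smooth2_Schwarz W HW _ u v X3 H).
Qed.

Lemma locally_line1 (u v : R) : W (u, v) -> locally u (fun s => W (s, v)).
Proof.
  intros H. apply (locally_2d_1d_const_y (fun u v => W (u, v))).
  now apply open_locally_2d.
Qed.

Lemma locally_line2 (u v : R) : W (u, v) -> locally v (fun s => W (u, s)).
Proof.
  intros H. apply (locally_2d_1d_const_x (fun u v => W (u, v))).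
  now apply open_locally_2d.
Qed.

(** Applied to [n . n = 1], [n . x_u = 0] and [n . x_v = 0], this and the next
    lemma give the Weingarten relations. *)
Lemma dot_const_du (x y : R -> R -> R3) (d u v : R) :
  smooth_map W x -> smooth_map W y ->
  (forall s t, W (s, t) -> dot (x s t) (y s t) = d) -> W (u, v) ->
  dot (du x u v) (y u v) + dot (x u v) (du y u v) = 0.
Proof.
  intros Hx Hy Hd H.
  rewrite <- (is_derive_unique _ _ _ (dot_derive1 x y u v Hx Hy H)).
  apply is_derive_unique.
  apply is_derive_ext_loc with (fun _ => d); [ | apply (is_derive_const (V := R_NormedModule))].
  generalize (locally_line1 u v H). apply filter_imp. intros s Hs. now rewrite Hd.
Qed.

Lemma dot_const_dv (x y : R -> R -> R3) (d u v : R) :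
  smooth_map W x -> smooth_map W y ->
  (forall s t, W (s, t) -> dot (x s t) (y s t) = d) -> W (u, v) ->
  dot (dv x u v) (y u v) + dot (x u v) (dv y u v) = 0.
Proof.
  intros Hx Hy Hd H.
  rewrite <- (is_derive_unique _ _ _ (dot_derive2 x y u v Hx Hy H)).
  apply is_derive_unique.
  apply is_derive_ext_loc with (fun _ => d); [ | apply (is_derive_const (V := R_NormedModule))].
  generalize (locally_line2 u v H). apply filter_imp. intros s Hs. now rewrite Hd.
Qed.

(** Coordinatewise Taylor expansion of the chart in [v], with [c0], [b0] and [n0]
    the coordinates of the curve, of the conormal and of the normal. *)
Lemma graph_jet (q r : R -> R -> R) (c0 b0 n0 k a b u : R) :
  smooth2 W r -> W (u, 0) ->
  (forall v, W (u, v) ->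
     q u v = c0 + v * b0
             + (k / 2 * v ^ 2 + a / 6 * v ^ 3 + b / 24 * v ^ 4 + r u v) * n0) ->
  D2 r u 0 = 0 -> D2 (D2 r) u 0 = 0 -> D2 (D2 (D2 r)) u 0 = 0 ->
  D2 q u 0 = b0 /\ D2 (D2 q) u 0 = k * n0 /\ D2 (D2 (D2 q)) u 0 = a * n0.
Proof.
  intros Hr H0 Hq R1 R2 R3.
  pose proof (smooth2_D2 W r Hr) as Hr1.
  pose proof (smooth2_D2 W _ Hr1) as Hr2.
  assert (Q1 : forall v, W (u, v) -> D2 q u v
            = b0 + (k * v + a / 2 * v ^ 2 + b / 6 * v ^ 3 + D2 r u v) * n0).
  { intros v H. apply is_derive_unique.
    eapply is_derive_ext_loc.
    - generalize (locally_line2 u v H). apply filter_imp.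
      intros s Hs. symmetry. apply (Hq s Hs).
    - pose proof (smooth2_derive2 W r u v Hr H) as D.
      auto_derive; [now exists (D2 r u v) | ].
      unfold D2. field. }
  assert (Q2 : forall v, W (u, v) -> D2 (D2 q) u v
            = (k + a * v + b / 2 * v ^ 2 + D2 (D2 r) u v) * n0).
  { intros v H. apply is_derive_unique.
    eapply is_derive_ext_loc.
    - generalize (locally_line2 u v H). apply filter_imp.
      intros s Hs. symmetry. apply (Q1 s Hs).
    - pose proof (smooth2_derive2 W _ u v Hr1 H) as D.
      auto_derive; [now exists (D2 (D2 r) u v) | ].
      unfold D2. field. }
  assert (Q3 : D2 (D2 (D2 q)) u 0 = (a + b * 0 + D2 (D2 (D2 r)) u 0) * n0).
  { apply is_derive_unique.
    eapply is_derive_ext_loc.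
    - generalize (locally_line2 u 0 H0). apply filter_imp.
      intros s Hs. symmetry. apply (Q2 s Hs).
    - pose proof (smooth2_derive2 W _ u 0 Hr2 H0) as D.
      auto_derive; [now exists (D2 (D2 (D2 r)) u 0) | ].
      unfold D2. field. }
  rewrite (Q1 0 H0), (Q2 0 H0), Q3, R1, R2, R3.
  split; [ | split]; ring.
Qed.

End SmoothMaps.

(** * Curves of umbilic points *)

Definition coef_dvdv (N : R3 -> R3) (x : R -> R -> R3) (u v : R) : R :=
  ffF x u v * sfg N x u v - ffG x u v * sff N x u v.
Definition coef_dudv (N : R3 -> R3) (x : R -> R -> R3) (u v : R) : R :=
  ffE x u v * sfg N x u v - ffG x u v * sfe N x u v.
Definition coef_dudu (N : R3 -> R3) (x : R -> R -> R3) (u v : R) : R :=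
  ffE x u v * sff N x u v - ffF x u v * sfe N x u v.

Lemma dot_scale3_l (s : R) (p q : R3) : dot (scale3 s p) q = s * dot p q.
Proof. unfold dot, scale3, coord1, coord2, coord3; simpl. ring. Qed.

Lemma dot_scale3_r (s : R) (p q : R3) : dot p (scale3 s q) = s * dot p q.
Proof. unfold dot, scale3, coord1, coord2, coord3; simpl. ring. Qed.

Lemma dot_add3_r (p q q' : R3) : dot p (add3 q q') = dot p q + dot p q'.
Proof.
  unfold dot, add3, coord1, coord2, coord3, plus; simpl.
  unfold prod_plus; simpl. unfold prod_plus, plus; simpl. ring.
Qed.

Lemma dot_cross_r (p q : R3) : dot q (cross p q) = 0.
Proof. unfold dot, cross, coord1, coord2, coord3; simpl. ring. Qed.

Lemma dot_cross_cross (p q : R3) :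
  dot (cross p q) (cross p q) = dot p p * dot q q - dot p q * dot p q.
Proof. unfold dot, cross, coord1, coord2, coord3; simpl. ring. Qed.

Section UmbilicCurve.

Variables (W : R * R -> Prop) (I : R -> Prop) (N : R3 -> R3)
  (x : R -> R -> R3) (k : R -> R).
Hypothesis HW : open W.
Hypothesis HI : forall u, I u -> W (u, 0).
Hypothesis HI' : forall u v, W (u, v) -> I u.
Hypothesis Hx : smooth_map W x.
Let n (u v : R) : R3 := N (x u v).
Hypothesis Hn : smooth_map W n.
Hypothesis Hnn : forall u v, W (u, v) -> dot (n u v) (n u v) = 1.
Hypothesis Hnu : forall u v, W (u, v) -> dot (n u v) (du x u v) = 0.
Hypothesis Hnv : forall u v, W (u, v) -> dot (n u v) (dv x u v) = 0.
Hypothesis Hadapted : forall u, I u -> dv x u 0 = cross (n u 0) (du x u 0).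
Hypothesis Hunit : forall u, I u -> dot (du x u 0) (du x u 0) = 1.
Hypothesis Humb : forall u, I u -> forall p q, (p, q) <> (0, 0) ->
  normal_curvature N x u 0 p q = k u.

Lemma axis_E (u : R) : I u -> ffE x u 0 = 1.
Proof. apply Hunit. Qed.

Lemma axis_F (u : R) : I u -> ffF x u 0 = 0.
Proof. intros H. unfold ffF. rewrite Hadapted by exact H. apply dot_cross_r. Qed.

Lemma axis_G (u : R) : I u -> ffG x u 0 = 1.
Proof.
  intros H. unfold ffG.
  rewrite Hadapted, dot_cross_cross, Hnn, Hunit, Hnu by auto. ring.
Qed.

(** The first fundamental form is the identity on the axis; the directions
    [(1, 0)], [(0, 1)] and [(1, 1)] determine the second one. *)
Lemma axis_second_form (u : R) :
  I u -> sfe N x u 0 = k u /\ sff N x u 0 = 0 /\ sfg N x u 0 = k u.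
Proof.
  intros H.
  pose proof (Humb u H 1 0 ltac:(intros E; injection E; lra)) as H10.
  pose proof (Humb u H 0 1 ltac:(intros E; injection E; lra)) as H01.
  pose proof (Humb u H 1 1 ltac:(intros E; injection E; lra)) as H11.
  unfold normal_curvature in *.
  rewrite axis_E, axis_F, axis_G in * by exact H.
  replace (1 * 1 ^ 2 + 2 * 0 * 1 * 0 + 1 * 0 ^ 2) with 1 in H10 by ring.
  replace (1 * 0 ^ 2 + 2 * 0 * 0 * 1 + 1 * 1 ^ 2) with 1 in H01 by ring.
  replace (1 * 1 ^ 2 + 2 * 0 * 1 * 1 + 1 * 1 ^ 2) with 2 in H11 by ring.
  assert (E1 : sfe N x u 0 = k u) by lra.
  assert (E2 : sfg N x u 0 = k u) by lra.
  split; [exact E1 | split; [ | exact E2]].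
  assert (H2 : sfe N x u 0 * 1 ^ 2 + 2 * sff N x u 0 * 1 * 1 + sfg N x u 0 * 1 ^ 2
               = 2 * k u) by lra.
  lra.
Qed.

Lemma sfe_weingarten (u v : R) :
  W (u, v) -> sfe N x u v = - dot (du x u v) (du n u v).
Proof.
  intros H.
  pose proof (dot_const_du W HW n (du x) 0 u v Hn (smooth_map_du W x Hx) Hnu H) as E.
  unfold sfe. fold (n u v). rewrite (dot_comm (du (du x) u v)), (dot_comm (du x u v)).
  lra.
Qed.

Lemma sff_weingarten (u v : R) :
  W (u, v) -> sff N x u v = - dot (dv x u v) (du n u v).
Proof.
  intros H.
  pose proof (dot_const_du W HW n (dv x) 0 u v Hn (smooth_map_dv W x Hx) Hnv H) as E.
  rewrite (du_dv_comm W HW x u v Hx H) in E.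
  unfold sff. fold (n u v). rewrite (dot_comm (dv (du x) u v)), (dot_comm (dv x u v)).
  lra.
Qed.

Lemma dot_n_du (u v : R) : W (u, v) -> dot (n u v) (du n u v) = 0.
Proof.
  intros H. pose proof (dot_const_du W HW n n 1 u v Hn Hn Hnn H) as E.
  rewrite (dot_comm (du n u v)) in E. lra.
Qed.

Lemma dot_n_dv (u v : R) : W (u, v) -> dot (n u v) (dv n u v) = 0.
Proof.
  intros H. pose proof (dot_const_dv W HW n n 1 u v Hn Hn Hnn H) as E.
  rewrite (dot_comm (dv n u v)) in E. lra.
Qed.

(** With the next lemma: the Weingarten map is [k] times the identity at an
    umbilic point. *)
Lemma axis_du_n (u : R) : I u -> du n u 0 = scale3 (- k u) (du x u 0).
Proof.
  intros H. pose proof (HI u H) as H0.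
  destruct (axis_second_form u H) as [E1 [E2 _]].
  apply (frame_determines (du x u 0) (n u 0)); auto.
  - rewrite dot_scale3_l, Hunit by exact H.
    rewrite sfe_weingarten, dot_comm in E1 by exact H0. lra.
  - rewrite dot_scale3_l, (dot_comm (du n u 0)), (dot_comm (du x u 0)).
    rewrite dot_n_du, Hnu by exact H0. ring.
  - rewrite dot_scale3_l, dot_cross_r, <- Hadapted by exact H.
    rewrite sff_weingarten, dot_comm in E2 by exact H0. lra.
Qed.

Lemma axis_dv_n (u : R) : I u -> dv n u 0 = scale3 (- k u) (dv x u 0).
Proof.
  intros H. pose proof (HI u H) as H0.
  destruct (axis_second_form u H) as [_ [E2 E3]].
  pose proof (dot_const_dv W HW n (du x) 0 u 0 Hn (smooth_map_du W x Hx) Hnu H0) as W2.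
  pose proof (dot_const_dv W HW n (dv x) 0 u 0 Hn (smooth_map_dv W x Hx) Hnv H0) as W3.
  unfold sff in E2. unfold sfg in E3. fold (n u 0) in E2, E3.
  rewrite dot_comm in E2, E3. rewrite E2 in W2. rewrite E3 in W3.
  apply (frame_determines (du x u 0) (n u 0)); auto.
  - rewrite dot_scale3_l, (dot_comm (dv x u 0)). fold (ffF x u 0).
    rewrite axis_F by exact H. lra.
  - rewrite dot_scale3_l, (dot_comm (dv n u 0)), (dot_comm (dv x u 0)).
    rewrite dot_n_dv, Hnv by exact H0. ring.
  - rewrite <- Hadapted, dot_scale3_l by exact H. fold (ffG x u 0).
    rewrite axis_G by exact H. lra.
Qed.

Lemma smooth2_sfe : smooth2 W (sfe N x).
Proof. apply (smooth2_dot W HW (du (du x)) n); [now repeat apply smooth_map_du | exact Hn]. Qed.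

Lemma smooth2_sff : smooth2 W (sff N x).
Proof.
  apply (smooth2_dot W HW (dv (du x)) n); [ | exact Hn].
  now apply smooth_map_dv, smooth_map_du.
Qed.

Lemma smooth2_sfg : smooth2 W (sfg N x).
Proof. apply (smooth2_dot W HW (dv (dv x)) n); [now repeat apply smooth_map_dv | exact Hn]. Qed.

Lemma smooth2_ffE : smooth2 W (ffE x).
Proof. apply (smooth2_dot W HW (du x) (du x)); now apply smooth_map_du. Qed.

Lemma smooth2_ffF : smooth2 W (ffF x).
Proof. apply (smooth2_dot W HW (du x) (dv x)); [now apply smooth_map_du | now apply smooth_map_dv]. Qed.

Lemma smooth2_ffG : smooth2 W (ffG x).
Proof. apply (smooth2_dot W HW (dv x) (dv x)); now apply smooth_map_dv. Qed.

Lemma I_locally (u : R) : I u -> locally u I.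
Proof.
  intros H. generalize (locally_line1 W HW u 0 (HI u H)). apply filter_imp.
  intros s. apply HI'.
Qed.

Lemma k_derive (u : R) : I u -> is_derive k u (Derive k u).
Proof.
  intros H. apply Derive_correct.
  apply ex_derive_ext_loc with (fun s => sfe N x s 0).
  - generalize (I_locally u H). apply filter_imp. intros s Hs.
    exact (proj1 (axis_second_form s Hs)).
  - eexists. apply (smooth2_derive1 W _ u 0 smooth2_sfe), HI, H.
Qed.

(** A relation valid along the axis can be differentiated in [u]; exchanging the
    partial derivatives then gives information transversal to the axis. *)
Lemma derive_on_axis (p q : R -> R -> R) (u : R) :
  smooth2 W p -> smooth2 W q -> I u ->
  (forall s, I s -> D2 p s 0 = - k s * D2 q s 0) ->
  D2 (D1 p) u 0 = - Derive k u * D2 q u 0 + - k u * D2 (D1 q) u 0.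
Proof.
  intros Hp Hq H E. pose proof (HI u H) as H0.
  rewrite <- !(smooth2_Schwarz W HW) by assumption.
  apply is_derive_unique.
  apply is_derive_ext_loc with (fun s => - k s * D2 q s 0).
  - generalize (I_locally u H). apply filter_imp. intros s Hs. symmetry. now apply E.
  - apply (is_derive_mult (fun s => - k s) (fun s => D2 q s 0));
      [ | | intros; apply Rmult_comm].
    + apply @is_derive_opp. now apply k_derive.
    + apply (smooth2_derive1 W (D2 q)); [now apply smooth2_D2 | exact H0].
Qed.

(** This is where [k'] enters the equation. *)
Lemma axis_dv_du_n (u : R) : I u ->
  dv (du n) u 0 = add3 (scale3 (- Derive k u) (dv x u 0)) (scale3 (- k u) (dv (du x) u 0)).
Proof.
  intros H. destruct Hn as [N1 [N2 N3]]. destruct Hx as [X1 [X2 X3]].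
  apply R3_eq.
  - apply (derive_on_axis (fun u v => coord1 (n u v)) (fun u v => coord1 (x u v))); auto.
    intros s Hs. exact (f_equal coord1 (axis_dv_n s Hs)).
  - apply (derive_on_axis (fun u v => coord2 (n u v)) (fun u v => coord2 (x u v))); auto.
    intros s Hs. exact (f_equal coord2 (axis_dv_n s Hs)).
  - apply (derive_on_axis (fun u v => coord3 (n u v)) (fun u v => coord3 (x u v))); auto.
    intros s Hs. exact (f_equal coord3 (axis_dv_n s Hs)).
Qed.

Lemma axis_D2_E (u : R) : I u ->
  D2 (ffE x) u 0 = 2 * dot (dv (du x) u 0) (du x u 0).
Proof.
  intros H. pose proof (smooth_map_du W x Hx) as S.
  unfold D2, ffE. rewrite (is_derive_unique _ _ _ (dot_derive2 W _ _ u 0 S S (HI u H))).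
  rewrite (dot_comm (du x u 0)). ring.
Qed.

Lemma axis_D2_e (u : R) : I u -> D2 (sfe N x) u 0 = k u * D2 (ffE x) u 0.
Proof.
  intros H. pose proof (HI u H) as H0. pose proof (smooth_map_du W x Hx) as S.
  pose proof (dot_derive2 W _ _ u 0 S (smooth_map_du W n Hn) H0) as D.
  rewrite axis_D2_E by exact H.
  apply is_derive_unique.
  apply is_derive_ext_loc with (fun v => - dot (du x u v) (du n u v)).
  - generalize (locally_line2 W HW u 0 H0). apply filter_imp.
    intros s Hs. symmetry. now apply sfe_weingarten.
  - evar_last; [apply @is_derive_opp, D | ].
    unfold opp; simpl.
    rewrite axis_du_n, axis_dv_du_n by exact H.
    rewrite dot_add3_r, !dot_scale3_r. fold (ffF x u 0). rewrite axis_F by exact H.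
    rewrite (dot_comm (du x u 0)). ring.
Qed.

(** The term [k'] comes from [- x_v . n_uv]; the other terms are those of
    [k F_v], as if the Weingarten map were [k u] times the identity near the
    axis. *)
Lemma axis_D2_f (u : R) :
  I u -> D2 (sff N x) u 0 = k u * D2 (ffF x) u 0 + Derive k u.
Proof.
  intros H. pose proof (HI u H) as H0.
  pose proof (smooth_map_du W x Hx) as Su. pose proof (smooth_map_dv W x Hx) as Sv.
  pose proof (dot_derive2 W _ _ u 0 Sv (smooth_map_du W n Hn) H0) as D.
  unfold D2 at 2, ffF. rewrite (is_derive_unique _ _ _ (dot_derive2 W _ _ u 0 Su Sv H0)).
  apply is_derive_unique.
  apply is_derive_ext_loc with (fun v => - dot (dv x u v) (du n u v)).
  - generalize (locally_line2 W HW u 0 H0). apply filter_imp.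
    intros s Hs. symmetry. now apply sff_weingarten.
  - evar_last; [apply @is_derive_opp, D | ].
    unfold opp; simpl.
    rewrite axis_du_n, axis_dv_du_n by exact H.
    rewrite dot_add3_r, !dot_scale3_r. fold (ffG x u 0). rewrite axis_G by exact H.
    rewrite (dot_comm (dv (du x) u 0)), (dot_comm (du x u 0)). ring.
Qed.

Variable a : R -> R.
Hypothesis Hjet2 : forall u, I u -> dv (dv x) u 0 = scale3 (k u) (n u 0).
Hypothesis Hjet3 : forall u, I u -> dv (dv (dv x)) u 0 = scale3 (a u) (n u 0).

Lemma axis_D2_G (u : R) : I u -> D2 (ffG x) u 0 = 0.
Proof.
  intros H. pose proof (HI u H) as H0. pose proof (smooth_map_dv W x Hx) as S.
  unfold D2, ffG. rewrite (is_derive_unique _ _ _ (dot_derive2 W _ _ u 0 S S H0)).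
  rewrite Hjet2, dot_scale3_l, dot_scale3_r, (dot_comm (dv x u 0)), Hnv by auto. ring.
Qed.

Lemma axis_D2_g (u : R) : I u -> D2 (sfg N x) u 0 = a u.
Proof.
  intros H. pose proof (HI u H) as H0.
  pose proof (smooth_map_dv W _ (smooth_map_dv W x Hx)) as S.
  etransitivity; [exact (is_derive_unique _ _ _ (dot_derive2 W _ n u 0 S Hn H0)) | ].
  rewrite Hjet2, Hjet3, !dot_scale3_l, Hnn, dot_n_dv by auto. ring.
Qed.

Lemma D2_form (e f g h : R -> R -> R) (u : R) :
  smooth2 W e -> smooth2 W f -> smooth2 W g -> smooth2 W h -> I u ->
  D2 (fun u v => e u v * f u v - g u v * h u v) u 0
  = D2 e u 0 * f u 0 + e u 0 * D2 f u 0 - (D2 g u 0 * h u 0 + g u 0 * D2 h u 0).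
Proof.
  intros He Hf Hg Hh H. pose proof (HI u H) as H0.
  apply is_derive_unique.
  pose proof (smooth2_derive2 W e u 0 He H0) as De.
  pose proof (smooth2_derive2 W f u 0 Hf H0) as Df.
  pose proof (smooth2_derive2 W g u 0 Hg H0) as Dg.
  pose proof (smooth2_derive2 W h u 0 Hh H0) as Dh.
  exact (is_derive_minus _ _ _ _ _ (is_derive_mult _ _ _ _ _ De Df Rmult_comm)
           (is_derive_mult _ _ _ _ _ Dg Dh Rmult_comm)).
Qed.

(** Apart from the terms in [k'] and [a], the derivatives of the second form are [k]
    times those of the first one, and these cancel in the minors of the two
    forms. *)
Lemma axis_D2_coef_dvdv (u : R) : I u -> D2 (coef_dvdv N x) u 0 = - Derive k u.
Proof.
  intros H. destruct (axis_second_form u H) as [E1 [E2 E3]].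
  unfold coef_dvdv. rewrite D2_form
    by auto using smooth2_ffE, smooth2_ffF, smooth2_ffG, smooth2_sfe, smooth2_sff, smooth2_sfg.
  rewrite E2, E3, axis_F, axis_G, axis_D2_G, axis_D2_f by exact H. ring.
Qed.

Lemma axis_D2_coef_dudv (u : R) : I u -> D2 (coef_dudv N x) u 0 = a u.
Proof.
  intros H. destruct (axis_second_form u H) as [E1 [E2 E3]].
  unfold coef_dudv. rewrite D2_form
    by auto using smooth2_ffE, smooth2_ffF, smooth2_ffG, smooth2_sfe, smooth2_sff, smooth2_sfg.
  rewrite E1, E3, axis_E, axis_G, axis_D2_G, axis_D2_g, axis_D2_e by exact H. ring.
Qed.

Lemma axis_D2_coef_dudu (u : R) : I u -> D2 (coef_dudu N x) u 0 = Derive k u.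
Proof.
  intros H. destruct (axis_second_form u H) as [E1 [E2 E3]].
  unfold coef_dudu. rewrite D2_form
    by auto using smooth2_ffE, smooth2_ffF, smooth2_ffG, smooth2_sfe, smooth2_sff, smooth2_sfg.
  rewrite E1, E2, axis_E, axis_F, axis_D2_f by exact H. ring.
Qed.

Lemma axis_coef_zero (u : R) :
  I u -> coef_dvdv N x u 0 = 0 /\ coef_dudv N x u 0 = 0 /\ coef_dudu N x u 0 = 0.
Proof.
  intros H. destruct (axis_second_form u H) as [E1 [E2 E3]].
  unfold coef_dvdv, coef_dudv, coef_dudu.
  rewrite E1, E2, E3, axis_E, axis_F, axis_G by exact H. repeat split; ring.
Qed.

Lemma smooth2_coef :
  smooth2 W (coef_dvdv N x) /\ smooth2 W (coef_dudv N x) /\ smooth2 W (coef_dudu N x).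
Proof.
  repeat split; apply smooth2_minus; try exact HW; apply smooth2_mult;
    auto using smooth2_ffE, smooth2_ffF, smooth2_ffG, smooth2_sfe, smooth2_sff, smooth2_sfg.
Qed.

End UmbilicCurve.

(** * The adapted chart *)

Lemma div_v_axis (phi : R -> R -> R) (u : R) : div_v phi u 0 = D2 phi u 0.
Proof. unfold div_v. now destruct (Req_EM_T 0 0). Qed.

Section AdaptedChart.

Variables (M : R3 -> Prop) (N : R3 -> R3) (I : R -> Prop) (c : R -> R3)
  (k a b : R -> R) (W : R * R -> Prop) (alpha : R -> R -> R3) (r : R -> R -> R).
Hypothesis hN : unit_normal_field M N.
Hypothesis harc : forall u, I u -> dot (Derive3 c u) (Derive3 c u) = 1.
Hypothesis humb : forall u, I u -> umbilic_with_curvature M N (c u) (k u).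
Hypothesis halpha : local_parametrization M W alpha.
Hypothesis hWc : forall u, I u -> W (u, 0).
Hypothesis hWI : forall u v, W (u, v) -> I u.
Hypothesis hr : smooth2 W r.
Hypothesis hr5 : forall u, I u ->
  forall j : nat, (j < 5)%nat -> Derive_n (fun v => r u v) j 0 = 0.
Hypothesis hchart : forall u v, W (u, v) ->
  alpha u v =
    add3 (add3 (c u) (scale3 v (cross (N (c u)) (Derive3 c u))))
         (scale3 (k u / 2 * v ^ 2 + a u / 6 * v ^ 3 + b u / 24 * v ^ 4 + r u v)
                 (N (c u))).

Lemma chart_coord (u v : R) : W (u, v) ->
  let phi := k u / 2 * v ^ 2 + a u / 6 * v ^ 3 + b u / 24 * v ^ 4 + r u v in
  let B := cross (N (c u)) (Derive3 c u) in
  coord1 (alpha u v) = coord1 (c u) + v * coord1 B + phi * coord1 (N (c u)) /\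
  coord2 (alpha u v) = coord2 (c u) + v * coord2 B + phi * coord2 (N (c u)) /\
  coord3 (alpha u v) = coord3 (c u) + v * coord3 B + phi * coord3 (N (c u)).
Proof. intros H. rewrite (hchart u v H). repeat split. Qed.

Lemma chart_axis (u : R) : I u -> alpha u 0 = c u.
Proof.
  intros H. pose proof (hr5 u H 0%nat ltac:(lia)) as R0. simpl in R0.
  destruct (chart_coord u 0 (hWc u H)) as [E1 [E2 E3]].
  rewrite R0 in E1, E2, E3.
  apply R3_eq; [rewrite E1 | rewrite E2 | rewrite E3]; ring.
Qed.

Lemma chart_jet (u : R) : I u ->
  dv alpha u 0 = cross (N (c u)) (Derive3 c u) /\
  dv (dv alpha) u 0 = scale3 (k u) (N (c u)) /\
  dv (dv (dv alpha)) u 0 = scale3 (a u) (N (c u)).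
Proof.
  intros H. pose proof (proj1 halpha) as HW. pose proof (hWc u H) as H0.
  pose proof (hr5 u H 1%nat ltac:(lia)) as R1.
  pose proof (hr5 u H 2%nat ltac:(lia)) as R2.
  pose proof (hr5 u H 3%nat ltac:(lia)) as R3'.
  destruct (graph_jet W HW (fun u v => coord1 (alpha u v)) r _ _ _ _ _ _ u hr H0
              (fun v Hv => proj1 (chart_coord u v Hv)) R1 R2 R3') as [A1 [A2 A3]].
  destruct (graph_jet W HW (fun u v => coord2 (alpha u v)) r _ _ _ _ _ _ u hr H0
              (fun v Hv => proj1 (proj2 (chart_coord u v Hv))) R1 R2 R3')
    as [B1 [B2 B3]].
  destruct (graph_jet W HW (fun u v => coord3 (alpha u v)) r _ _ _ _ _ _ u hr H0
              (fun v Hv => proj2 (proj2 (chart_coord u v Hv))) R1 R2 R3')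
    as [C1 [C2 C3]].
  split; [ | split]; apply R3_eq; assumption.
Qed.

Lemma chart_du (u : R) : I u -> du alpha u 0 = Derive3 c u.
Proof.
  intros H.
  assert (E : locally u (fun s => alpha s 0 = c s)).
  { generalize (I_locally W I (proj1 halpha) hWc hWI u H). apply filter_imp.
    intros s Hs. now apply chart_axis. }
  apply R3_eq; apply Derive_ext_loc; revert E; apply filter_imp; intros s Es;
    now rewrite Es.
Qed.

(** On the axis the divided equation is [- k' dv^2 + a du dv + k' du^2 = 0].
    The regularity of [k'], which the quadratic contact requires, comes from
    that of the third coefficient. *)
Lemma divided_coefficients (u0 : R) : I u0 ->
  lipschitz_near (div_v (coef_dvdv N alpha)) u0 0 /\
  lipschitz_near (div_v (coef_dudv N alpha)) u0 0 /\
  lipschitz_near (div_v (coef_dudu N alpha)) u0 0 /\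
  (forall u, I u ->
     div_v (coef_dvdv N alpha) u 0 = - Derive k u /\
     div_v (coef_dudv N alpha) u 0 = a u /\
     div_v (coef_dudu N alpha) u 0 = Derive k u) /\
  ex_derive (Derive k) u0.
Proof.
  intros Hu0.
  pose proof (proj1 halpha) as HW. pose proof (proj1 (proj2 halpha)) as Hx.
  destruct (hN W alpha halpha) as [Hn Hdot].
  assert (Hnn : forall u v, W (u, v) -> dot (N (alpha u v)) (N (alpha u v)) = 1)
    by (intros; now apply Hdot).
  assert (Hnu : forall u v, W (u, v) -> dot (N (alpha u v)) (du alpha u v) = 0)
    by (intros; now apply Hdot).
  assert (Hnv : forall u v, W (u, v) -> dot (N (alpha u v)) (dv alpha u v) = 0)
    by (intros; now apply Hdot).
  assert (Had : forall u, I u -> dv alpha u 0 = cross (N (alpha u 0)) (du alpha u 0)).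
  { intros u H. rewrite chart_axis, chart_du by exact H. exact (proj1 (chart_jet u H)). }
  assert (Hunit : forall u, I u -> dot (du alpha u 0) (du alpha u 0) = 1).
  { intros u H. rewrite chart_du by exact H. now apply harc. }
  assert (Hum : forall u, I u -> forall p q, (p, q) <> (0, 0) ->
            normal_curvature N alpha u 0 p q = k u).
  { intros u H. apply (proj2 (humb u H) W alpha u 0 halpha (hWc u H)).
    now apply chart_axis. }
  assert (Hj2 : forall u, I u -> dv (dv alpha) u 0 = scale3 (k u) (N (alpha u 0))).
  { intros u H. rewrite chart_axis by exact H. exact (proj1 (proj2 (chart_jet u H))). }
  assert (Hj3 : forall u, I u -> dv (dv (dv alpha)) u 0 = scale3 (a u) (N (alpha u 0))).
  { intros u H. rewrite chart_axis by exact H. exact (proj2 (proj2 (chart_jet u H))). }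
  destruct (smooth2_coef W N alpha HW Hx Hn) as [SL [SM SP]].
  assert (Z : forall u, W (u, 0) ->
            coef_dvdv N alpha u 0 = 0 /\ coef_dudv N alpha u 0 = 0 /\ coef_dudu N alpha u 0 = 0).
  { intros u H. apply (axis_coef_zero W I N alpha k); eauto. }
  assert (DP : forall u, I u -> D2 (coef_dudu N alpha) u 0 = Derive k u).
  { intros u H. apply (axis_D2_coef_dudu W I N alpha k); eauto. }
  split; [ | split; [ | split; [ | split]]].
  - apply (div_v_lipschitz_near W HW); [exact SL | auto | intros; now apply Z].
  - apply (div_v_lipschitz_near W HW); [exact SM | auto | intros; now apply Z].
  - apply (div_v_lipschitz_near W HW); [exact SP | auto | intros; now apply Z].
  - intros u H. rewrite !div_v_axis. split; [ | split].
    + apply (axis_D2_coef_dvdv W I N alpha k); eauto.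
    + apply (axis_D2_coef_dudv W I N alpha k); eauto.
    + now apply DP.
  - apply ex_derive_ext_loc with (fun u => D2 (coef_dudu N alpha) u 0).
    + generalize (I_locally W I HW hWc hWI u0 Hu0). apply filter_imp. exact DP.
    + eexists. apply (smooth2_derive1 W (D2 (coef_dudu N alpha))); [now apply smooth2_D2 | auto].
Qed.

End AdaptedChart.

(** * Principal foliations along a curve of umbilic points *)

Theorem proposition2
  (M : R3 -> Prop) (N : R3 -> R3)
  (hM : regular_surface M) (hN : unit_normal_field M N)
  (i0 i1 : Rbar) (c : R -> R3) (k : R -> R)
  (hc : smooth_curve (between i0 i1) c)
  (harc : forall u, between i0 i1 u -> dot (Derive3 c u) (Derive3 c u) = 1)
  (humb : forall u, between i0 i1 u -> umbilic_with_curvature M N (c u) (k u))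
  (W : R * R -> Prop) (alpha : R -> R -> R3)
  (halpha : local_parametrization M W alpha)
  (hWc : forall u, between i0 i1 u -> W (u, 0))
  (hWI : forall u v, W (u, v) -> between i0 i1 u)
  (a b : R -> R) (r : R -> R -> R)
  (ha : smooth1 (between i0 i1) a) (hb : smooth1 (between i0 i1) b)
  (hr : smooth2 W r)
  (hr5 : forall u, between i0 i1 u ->
     forall j : nat, (j < 5)%nat -> Derive_n (fun v => r u v) j 0 = 0)
  (hchart : forall u v, W (u, v) ->
     alpha u v =
       add3 (add3 (c u) (scale3 v (cross (N (c u)) (Derive3 c u))))
            (scale3 (k u / 2 * v ^ 2 + a u / 6 * v ^ 3 + b u / 24 * v ^ 4 + r u v)
                    (N (c u))))
  (u0 : R) (hu0 : between i0 i1 u0)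
  (hgrad : (Derive (fun u => mean_curvature N alpha u 0) u0,
            Derive (fun v => mean_curvature N alpha u0 v) 0) <> (0, 0)) :
  (Derive k u0 <> 0 ->
     exists (eps : R) (X Y : R * R -> R * R),
       0 < eps /\
       (forall w, square u0 eps w -> W w) /\
       principal_foliations N alpha (square u0 eps) X Y /\
       transversal_to_axis (square u0 eps) X /\
       transversal_to_axis (square u0 eps) Y)
  /\
  (Derive k u0 = 0 -> Derive_n k 2 u0 <> 0 -> a u0 <> 0 ->
     exists (eps : R) (X Y : R * R -> R * R),
       0 < eps /\
       (forall w, square u0 eps w -> W w) /\
       principal_foliations N alpha (square u0 eps) X Y /\
       transversal_to_axis (square u0 eps) X /\
       quadratic_contact_with_axis (square u0 eps) Y u0).
Proof.
  pose (I := between i0 i1).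
  pose proof (proj1 halpha) as HW.
  destruct (divided_coefficients M N I c k a b W alpha r hN harc humb halpha hWc hWI
              hr hr5 hchart u0 hu0) as [Ll [Lm [Lp [Haxis Hk2]]]].
  set (l := div_v (coef_dvdv N alpha)) in *.
  set (m := div_v (coef_dudv N alpha)) in *.
  set (p := div_v (coef_dudu N alpha)) in *.
  destruct (Haxis u0 hu0) as [El [Em Ep]].
  assert (HWQ : locally_2d (fun u v => W (u, v)) u0 0).
  { apply open_locally_2d; [exact HW | now apply hWc]. }
  assert (Hdisc : Derive k u0 <> 0 \/ a u0 <> 0 -> 0 < discriminant l m p u0 0).
  { intros H. unfold discriminant. rewrite El, Em, Ep.
    replace (a u0 * a u0 + -4 * (- Derive k u0 * Derive k u0))
      with (Rsqr (a u0) + 4 * Rsqr (Derive k u0)) by (unfold Rsqr; ring).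
    pose proof (Rle_0_sqr (a u0)). pose proof (Rle_0_sqr (Derive k u0)).
    destruct H as [H | H]; apply Rsqr_pos_lt in H; lra. }
  split.
  - intros Hk.
    assert (HD : 0 < discriminant l m p u0 0) by (apply Hdisc; now left).
    destruct (sign_choice l m p u0 HD) as [sigma [Hs Hr]].
    (* On the axis [p] is [k'], so that this condition is the transversality of [Y]. *)
    assert (HQ : locally_2d (fun u v => W (u, v) /\ p u v <> 0) u0 0).
    { apply locally_2d_and; [exact HWQ | ].
      apply continuity_2d_pt_neq_0; [now apply lipschitz_near_continuity | ].
      now rewrite Ep. }
    destruct (quadratic_line_fields l m p u0 Ll Lm Lp HD sigma Hs Hr _ HQ)
      as [eps [X [Y [f [Heps [HQ' [FX [FY [Hpar [Heq [HX [HY _]]]]]]]]]]]].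
    exists eps, X, Y. split; [exact Heps | ].
    split; [intros [u v] Huv; now apply HQ' | ].
    split; [exact (conj FX (conj FY (conj Hpar Heq))) | ].
    split; apply transversal_of_snd_neq_0; intros u Hu; [apply HX | ].
    rewrite HY by exact Hu. destruct (HQ' u 0 Hu) as [_ Hp]. lra.
  - intros Hk Hkk Ha.
    assert (HD : 0 < discriminant l m p u0 0) by (apply Hdisc; now right).
    destruct (sign_choice l m p u0 HD) as [sigma [Hs Hr]].
    destruct (quadratic_line_fields l m p u0 Ll Lm Lp HD sigma Hs Hr _ HWQ)
      as [eps [X [Y [f [Heps [HQ' [FX [FY [Hpar [Heq [HX [_ [SY [Bf Hf]]]]]]]]]]]]]].
    exists eps, X, Y. split; [exact Heps | ].
    split; [intros [u v] Huv; now apply HQ' | ].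
    split; [exact (conj FX (conj FY (conj Hpar Heq))) | ].
    split; [apply transversal_of_snd_neq_0; intros u Hu; apply HX | ].
    set (R0 := root l m p sigma u0 0) in *.
    assert (Hsq : forall u, Rabs (u - u0) < eps -> square u0 eps (u, 0)).
    { intros u Hu. split; [exact Hu | ]. simpl. rewrite Rabs_R0. exact Heps. }
    assert (Hfk : locally u0 (fun u =>
              Derive k u * (-2 * / root l m p sigma u 0) = f u 0)).
    { exists (mkposreal eps Heps). intros u Hu.
      rewrite (Hf u 0 (Hsq u Hu)).
      destruct (Haxis u (hWI u 0 (HQ' u 0 (Hsq u Hu)))) as [_ [_ ->]]. reflexivity. }
    (* On the axis the slope is [-2 k' / w], whose derivative at [u0] is twice this
       witness. *)
    apply (quadratic_contact_of_slope _ _ f u0 (- Derive_n k 2 u0 * / R0) SY Bf).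
    + rewrite <- (locally_singleton _ _ Hfk), Hk. ring.
    + apply is_derive_ext_loc with (1 := Hfk).
      replace (2 * (- Derive_n k 2 u0 * / R0))
        with (Derive_n k 2 u0 * (-2 * / R0)) by ring.
      apply (is_derive_mult_vanishing (Derive k) (fun u => -2 * / root l m p sigma u 0));
        [exact Hk | exact (Derive_correct _ _ Hk2) | ].
      apply (continuous_scal_r (-2) (fun u => / root l m p sigma u 0)).
      apply continuity_pt_filterlim, continuity_pt_inv; [ | exact Hr].
      pose proof (root_continuity l m p u0 Ll Lm Lp sigma) as HC.
      apply continuity_pt_filterlim, filterlim_locally. intros e.
      exact (locally_2d_1d_const_y _ _ _ (HC e)).
    + apply Rmult_integral_contrapositive_currified;
        [lra | now apply Rinv_neq_0_compat].
Qed.
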